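(* Let $d\ge2$ be an integer and put $$\alpha=2^{d^2+1},\qquad \delta=\frac{1}{2\alpha d^2},\qquad p=\left(\frac{\delta}{10}\right)^{d^2-1}.$$ Let $\epsilon>0$ be a target accuracy (such that the double logarithm below is defined, i.e. $\epsilon<1/\alpha$), let $0<\eta<1$, and let $k$ be a positive integer with $$k\;\ge\;\frac{\log_2\eta}{\log_2(1-p)}+\log_2\log_2\!\left(\frac{1}{\alpha\epsilon}\right).$$ Let $F=(f\circ g)^{\circ k}$ be the random map on $SU(d)$ described in the context. Then every $U\in SU(d)$ is mapped by $F$ to within distance $\epsilon$ of $\mathbb 1$ with probability at least $1-\eta$: $$\Pr\big[\|F(U)-\mathbb 1\|\le\epsilon\big]\ \ge\ 1-\eta .$$ $F(U)$ can be expanded, after a conjugation by a unitary independent of $U$, in the form $R_1UR_2U\cdots R_nU$ with unitary $R_i$ independent of $U$. The number $n$ of pulses equals the number of uses of $U$, namely $n=d^{2k}$, and, with $k$ taken to be the right-hand side of the displayed lower bound rounded up to an integer, $$n=d^{2k}\ \le\ d^2\left(\frac1\eta\right)^{2^{O(d^4)}}\left(\log_2\!\left(\frac1\epsilon\right)-d^2-1\right)^{2\log_2 d}.$$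
   Context: The norm $\|\cdot\|$ is the operator norm on $d\times d$ complex matrices, $\mathbb 1$ is the identity, and the distance of $W$ from $\mathbb 1$ is $\|W-\mathbb 1\|$. Let $|0\rangle,\dots,|d-1\rangle$ be the standard basis of $\mathbb C^d$ and $\omega=e^{2\pi i/d}$. The Weyl operators are the unitaries $X|x\rangle=|x+1 \bmod d\rangle$ and $Z|x\rangle=\omega^x|x\rangle$. For $\boldsymbol a=(a_1,a_2)\in[d]^2$, with $[d]=\{0,\dots,d-1\}$, put $\sigma_{\boldsymbol a}=Z^{a_1}X^{a_2}$. The map $f:SU(d)\to SU(d)$ is $$f(U)=\prod_{\boldsymbol a\in[d]^2}\sigma_{\boldsymbol a}U\sigma_{\boldsymbol a}^\dagger ,$$ where the factors are multiplied from left to right in increasing order of $da_1+a_2$. The random map $g$ is $g(U)=VUV^\dagger$, where each application of $g$ chooses $V\in SU(d)$ at random according to the Haar probability measure on $SU(d)$ (independently for each application, and independently of $U$). $(f\circ g)^{\circ k}$ denotes the $k$-fold composition of $f\circ g$. Probabilities are over the draws of $V$.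
   Formalization: The probability claim also assumes k ≥ log2(η)/log2(1−p), which is automatic when ε ≤ 1/(2α); without it the claim fails for ε close to 1/α, where the double logarithm tends to −∞ and k = 1 becomes admissible for every η. *)

(* Defs.v *)
From HB Require Import structures.
From mathcomp Require Import all_boot all_order all_algebra.
From mathcomp Require Import spectral.
From mathcomp Require Import complex.
From mathcomp Require Import all_classical all_reals all_analysis.

Set Implicit Arguments.
Unset Strict Implicit.
Unset Printing Implicit Defensive.

Import Order.TTheory GRing.Theory Num.Theory.
Import numFieldNormedType.Exports.

Local Open Scope classical_set_scope.
Local Open Scope sesquilinear_scope.
Local Open Scope complex_scope.
Local Open Scope ring_scope.

Definition l2norm (R : realType) (d : nat) (v : 'cV[R[i]]_d) : R :=
  Num.sqrt (\sum_(i < d) ComplexField.Normc.normc (v i ord0) ^+ 2).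

Definition opnorm (R : realType) (d : nat) (A : 'M[R[i]]_d) : R :=
  sup [set l2norm (A *m v) | v in [set v : 'cV[R[i]]_d | l2norm v <= 1]].

Definition omega (R : realType) (d : nat) : R[i] :=
  cos (2 * pi / d%:R) +i* sin (2 * pi / d%:R).

Definition weylX (R : realType) (d : nat) : 'M[R[i]]_d :=
  \matrix_(i, j) (i == ordS j)%:R.

Definition weylZ (R : realType) (d : nat) : 'M[R[i]]_d :=
  diag_mx (\row_(j < d) omega R d ^+ j).

Definition weyl (R : realType) (d : nat) (a1 a2 : nat) : 'M[R[i]]_d :=
  weylZ R d ^+ a1 *m weylX R d ^+ a2.

(* The nested product lists the factors in increasing order of d * a1 + a2. *)
Definition weyl_twirl (R : realType) (d : nat) (U : 'M[R[i]]_d) : 'M[R[i]]_d :=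
  \prod_(a1 < d) \prod_(a2 < d) (weyl R d a1 a2 *m U *m (weyl R d a1 a2)^t*).

Record SU (R : realType) (d : nat) := MkSU {
  su_val :> 'M[R[i]]_d;
  su_valP : (su_val \is unitarymx) && (\det su_val == 1) }.

HB.instance Definition _ (R : realType) (d : nat) :=
  [isSub for @su_val R d].
HB.instance Definition _ (R : realType) (d : nat) :=
  [Choice of SU R d by <:].

Lemma mx1_unitary (R : realType) (d : nat) :
  (1%:M : 'M[R[i]]_d) \is unitarymx.
Proof. by apply/unitarymxP; rewrite trmx1 map_mx1 mulmx1. Qed.

Lemma su1_subproof (R : realType) (d : nat) :
  ((1%:M : 'M[R[i]]_d) \is unitarymx) && (\det (1%:M : 'M[R[i]]_d) == 1).
Proof. by rewrite mx1_unitary det1 eqxx. Qed.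

Definition su1 (R : realType) (d : nat) : SU R d := MkSU (su1_subproof R d).

HB.instance Definition _ (R : realType) (d : nat) :=
  isPointed.Build (SU R d) (su1 R d).

Lemma suM_subproof (R : realType) (d : nat) (V W : SU R d) :
  ((su_val V *m su_val W) \is unitarymx)
  && (\det (su_val V *m su_val W) == 1).
Proof.
case: V W => [V /andP[uV /eqP dV]] [W /andP[uW /eqP dW]] /=.
by rewrite (mul_unitarymx uV uW) det_mulmx dV dW mulr1 eqxx.
Qed.

Definition suM (R : realType) (d : nat) (V W : SU R d) : SU R d :=
  MkSU (suM_subproof V W).

Lemma det_conj_unitary (R : realType) (d : nat) (S U : 'M[R[i]]_d) :
  S \is unitarymx -> \det (S *m U *m S^t*) = \det U.
Proof.
move=> /unitarymxP uS; rewrite !det_mulmx mulrAC -det_mulmx uS det1 mul1r //.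
Qed.

Lemma conj_unitary (R : realType) (d : nat) (S U : 'M[R[i]]_d) :
  S \is unitarymx -> U \is unitarymx -> S *m U *m S^t* \is unitarymx.
Proof.
move=> uS uU; have uSC : S^t* \is unitarymx by rewrite trmxC_unitary.
exact: (mul_unitarymx (mul_unitarymx uS uU) uSC).
Qed.

Lemma omega_norm (R : realType) (d : nat) : omega R d * (omega R d)^*%R = 1.
Proof.
apply/eqP; rewrite /omega /Num.conj /= eq_complex /=.
by rewrite mulrN opprK mulrN [X in - X + _]mulrC addNr -!expr2 cos2Dsin2 !eqxx.
Qed.

Lemma weylZ_unitary (R : realType) (d : nat) : weylZ R d \is unitarymx.
Proof.
apply/unitarymxP.
rewrite /weylZ tr_diag_mx map_diag_mx mulmx_diag -diag_const_mx.
congr diag_mx; apply/rowP => j; rewrite !mxE.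
by rewrite rmorphXn /= -exprMn omega_norm expr1n.
Qed.

Lemma weylX_unitary (R : realType) (d : nat) : weylX R d \is unitarymx.
Proof.
apply/unitarymxP/matrixP => i k; rewrite !mxE.
rewrite (bigD1 (ord_pred i)) //= !mxE ord_predK eqxx mul1r big1 ?addr0.
  by rewrite rmorph_nat eq_sym.
move=> j ji; rewrite !mxE; case: eqP => [ij|_]; last by rewrite mul0r.
by move: ji; rewrite ij ordSK eqxx.
Qed.

Lemma exp_unitary (R : realType) (d n : nat) (A : 'M[R[i]]_d) :
  A \is unitarymx -> A ^+ n \is unitarymx.
Proof.
move=> uA; elim: n => [|n IHn]; first by rewrite expr0 mx1_unitary.
by rewrite exprS; exact: (mul_unitarymx uA IHn).
Qed.

Lemma weyl_unitary (R : realType) (d a1 a2 : nat) :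
  weyl R d a1 a2 \is unitarymx.
Proof.
apply: mul_unitarymx; apply: exp_unitary.
  exact: weylZ_unitary.
exact: weylX_unitary.
Qed.

Lemma su_f_subproof (R : realType) (d : nat) (U : SU R d) :
  (weyl_twirl (su_val U) \is unitarymx) && (\det (weyl_twirl (su_val U)) == 1).
Proof.
case: U => [U /andP[uU /eqP dU]] /=.
have mulP (A B : 'M[R[i]]_d) :
    (A \is unitarymx) && (\det A == 1) -> (B \is unitarymx) && (\det B == 1) ->
    ((A * B)%R \is unitarymx) && (\det (A * B)%R == 1).
  move=> /andP[uA /eqP dA] /andP[uB /eqP dB].
  rewrite (mul_unitarymx uA uB) [X in \det X](erefl (A *m B)) det_mulmx dA dB.
  by rewrite mulr1 eqxx.
apply: (big_ind (fun A : 'M[R[i]]_d => (A \is unitarymx) && (\det A == 1))).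
- exact: su1_subproof.
- exact: mulP.
move=> a1 _.
apply: (big_ind (fun A : 'M[R[i]]_d => (A \is unitarymx) && (\det A == 1))).
- exact: su1_subproof.
- exact: mulP.
move=> a2 _; have uS := weyl_unitary R d a1 a2.
by rewrite conj_unitary // det_conj_unitary // dU eqxx.
Qed.

Definition su_f (R : realType) (d : nat) (U : SU R d) : SU R d :=
  MkSU (su_f_subproof U).

Lemma su_g_subproof (R : realType) (d : nat) (V U : SU R d) :
  (su_val V *m su_val U *m (su_val V)^t* \is unitarymx)
  && (\det (su_val V *m su_val U *m (su_val V)^t*) == 1).
Proof.
case: V U => [V /andP[uV _]] [U /andP[uU dU]] /=.
by rewrite conj_unitary // det_conj_unitary.
Qed.

Definition su_g (R : realType) (d : nat) (V U : SU R d) : SU R d :=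
  MkSU (su_g_subproof V U).

(* The composition of the maps f \o su_g V for V running through Vs; the first
   element of Vs is the draw used by the innermost application. *)
Definition su_F (R : realType) (d : nat) (Vs : seq (SU R d)) (U : SU R d) :
    SU R d :=
  foldl (fun U' V => su_f (su_g V U')) U Vs.

Definition su_open (R : realType) (d : nat) : set (set (SU R d)) :=
  [set O | forall A, O A ->
    exists2 r : R, 0 < r & forall B, opnorm (su_val B - su_val A) < r -> O B].
Arguments su_open : clear implicits.

(* SU(d) with the Borel sigma-algebra of the operator-norm topology. *)
Definition borelSU (R : realType) (d : nat) :=
  g_sigma_algebraType (su_open R d).

(* Left invariance characterizes the Haar probability measure, SU(d) being
   compact. *)
Definition is_haar (R : realType) (d : nat)
    (mu : probability (borelSU R d) R) : Prop :=
  forall (W : SU R d) (B : set (borelSU R d)), measurable B ->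
    mu [set V | B (suM W V)] = mu B.

Definition mutually_independent (R : realType) (d k : nat)
    (disp : measure_display) (T : measurableType disp) (P : probability T R)
    (V : 'I_k -> {RV P >-> borelSU R d}) : Prop :=
  forall (J : {set 'I_k}) (B : 'I_k -> set (borelSU R d)),
    (forall i, i \in J -> measurable (B i)) ->
    P [set w | forall i, i \in J -> B i (V i w)]
      = (\prod_(i in J) P [set w | B i (V i w)])%E.

Definition haar_draws (R : realType) (d k : nat)
    (disp : measure_display) (T : measurableType disp) (P : probability T R)
    (V : 'I_k -> {RV P >-> borelSU R d}) : Prop :=
  [/\ forall i, is_haar (distribution P (V i)) & mutually_independent V].

Definition log2 (R : realType) (x : R) : R := ln x / ln 2.

Definition alpha (R : realType) (d : nat) : R := 2 ^+ (d ^ 2 + 1).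

Definition delta (R : realType) (d : nat) : R :=
  1 / (2 * alpha R d * d%:R ^+ 2).

Definition succ_prob (R : realType) (d : nat) : R :=
  (delta R d / 10) ^+ (d ^ 2 - 1).

Definition trials (R : realType) (d : nat) (eta : R) : R :=
  log2 eta / log2 (1 - succ_prob R d).

(* For 0 < eps < 1 / alpha R d, nonnegative exactly when
   eps <= 1 / (2 * alpha R d); it tends to -oo as eps increases to
   1 / alpha R d. *)
Definition doublings (R : realType) (d : nat) (eps : R) : R :=
  log2 (log2 (1 / (alpha R d * eps))).

(* Main.v *)
(* Write b_n(e) = (1 + e)^n - 1 - n e. If D is diagonal unitary of determinant 1
   and Y = D (1 + E) is in SU(d), then the product of the shifts of D is 1, so
   f(Y) is a product of d^2 factors 1 + T E T^-1 with T unitary whose linear term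
   averages to d tr(E). As 1 + E is in SU(d), |tr E| <= b_d(|E|), whence
   |f(Y) - 1| <= d b_d(|Y - D|) + b_(d^2)(|Y - D|).
   With D = 1 this gives the contraction |f(U) - 1| <= alpha |U - 1|^2. With D a
   diagonalization of U it shows that f(V U V^-1) is within 1 / (4 alpha) of 1 for
   V in a ball around a diagonalizer, of radius about 2^(-d^2/2), much larger than
   delta. By left invariance a ball of radius r has Haar measure at least 1 / N
   when SU(d) is covered by N sets of diameter less than r; the Cayley transform
   of a square root, which has only d^2 real parameters, yields N <= 1 / p for
   d >= 3, and for d = 2 the first column of the matrix does.
   Each draw thus lands with probability at least p whatever came before. *)
Require Import Defs.
From HB Require Import structures.
From mathcomp Require Import all_boot all_order all_algebra.
From mathcomp Require Import spectral.
From mathcomp Require Import complex.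
From mathcomp Require Import all_classical all_reals all_analysis.
From mathcomp Require Import ring lra zify.

Set Implicit Arguments.
Unset Strict Implicit.
Unset Printing Implicit Defensive.

Import Order.TTheory GRing.Theory Num.Theory.
Import numFieldNormedType.Exports.

Local Open Scope classical_set_scope.
Local Open Scope sesquilinear_scope.
Local Open Scope complex_scope.
Local Open Scope ring_scope.

(** * The operator norm *)

(** Whether a draw lands depends on the state left by the earlier draws, so failures are not
    independent events. Instead of conditioning, each draw is rounded to one of finitely many codes
    with Borel fibres: independence is then applied to boxes of codes, and the bound (1 - p)^j
    becomes an induction on finite sums. Rounding is affordable because the iterate is Lipschitz in
    the draws and two strict inequalities leave room: the radius of the balls whose measure is
    estimated is smaller than the landing radius, and the distance guaranteed for rounded draws is
    strictly below [eps]. The exponent of [succ_prob] is the real dimension d^2 - 1 of SU(d), one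
    less than the number of Cayley coordinates. The surplus coordinate is paid for by the gap
    between the landing radius and [delta]; at d = 2 this gap does not cover the Cayley constants,
    hence a separate code with better ones. *)

Lemma sum_CauchySchwarz (R : rcfType) (I : finType) (a b : I -> R) :
  \sum_i a i * b i <=
  Num.sqrt (\sum_i a i ^+ 2) * Num.sqrt (\sum_i b i ^+ 2).
Proof.
set x := \sum_i a i ^+ 2; set y := \sum_i b i ^+ 2; set s := \sum_i _.
have x0 : 0 <= x by apply: sumr_ge0 => i _; exact: sqr_ge0.
have y0 : 0 <= y by apply: sumr_ge0 => i _; exact: sqr_ge0.
(* This is the sum of the squares of a i - t * b i. Taking t = s / y gives the claim, and for y = 0
   a large t contradicts 0 < s. *)
have quad (t : R) : 0 <= x - 2 * t * s + t ^+ 2 * y.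
  rewrite /x /y /s !mulr_sumr -sumrB -big_split /=; apply: sumr_ge0 => i _.
  rewrite (_ : _ + _ = (a i - t * b i) ^+ 2) ?sqr_ge0 //; ring.
rewrite -sqrtrM //; case: (lerP s 0) => [s0|s0].
  by apply: (le_trans s0); exact: sqrtr_ge0.
rewrite -(ger0_norm (ltW s0)) -sqrtr_sqr ler_sqrt ?mulr_ge0//.
move: y0; rewrite le_eqVlt => /orP[/eqP y0|y0].
  have := quad ((x + 1) / (2 * s)); rewrite -y0 mulr0 addr0.
  rewrite (_ : _ - _ = -1); first lra.
  by field; rewrite gt_eqF.
have := quad (s / y); rewrite (_ : _ + _ = x - s ^+ 2 / y); last first.
  by field; rewrite gt_eqF.
by rewrite subr_ge0 ler_pdivrMr.
Qed.

Section OperatorNorm.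
Variable R : realType.
Local Notation C := R[i].
Local Notation normc := (@ComplexField.Normc.normc R).

Lemma normc_ge0 (x : C) : 0 <= normc x.
Proof. by case: x => a b; exact: sqrtr_ge0. Qed.

Lemma le_normcD (x y : C) : normc (x + y) <= normc x + normc y.
Proof. exact: complex.le_normcD. Qed.

Lemma normcN (x : C) : normc (- x) = normc x.
Proof. exact: complex.normcN. Qed.

Lemma sqr_normc_Re (x : C) : normc x ^+ 2 = complex.Re (x^*%R * x).
Proof.
case: x => a b /=; rewrite sqr_sqrtr ?addr_ge0 ?sqr_ge0//; ring.
Qed.

Lemma sqr_normcE (x : C) : (normc x ^+ 2)%:C = x^*%R * x.
Proof.
rewrite sqr_normc_Re; apply/eqP; rewrite eq_complex /= eqxx /=.
by case: x => a b /=; apply/eqP; ring.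
Qed.

Lemma normc_sum (I : finType) (F : I -> C) :
  normc (\sum_i F i) <= \sum_i normc (F i).
Proof.
elim/big_rec2: _ => [|i y x _ le_xy]; first by rewrite ComplexField.Normc.normc0.
exact: le_trans (le_normcD _ _) (lerD _ _).
Qed.

Lemma unit_normc (x : C) : (normc x == 1) = (x^*%R * x == 1).
Proof.
rewrite -sqr_normcE -(rmorph1 (@real_complex_def R (Phant R))).
rewrite eq_complex /= eqxx andbT -[1 in RHS](expr1n _ 2).
by rewrite eqrXn2 ?normc_ge0.
Qed.

Section Vectors.
Variable d : nat.
Implicit Types (u v : 'cV[C]_d) (A B : 'M[C]_d).

Lemma sqr_l2norm v : l2norm v ^+ 2 = \sum_(i < d) normc (v i ord0) ^+ 2.
Proof. by rewrite sqr_sqrtr// sumr_ge0// => i _; exact: sqr_ge0. Qed.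

Lemma l2norm_ge0 v : 0 <= l2norm v.
Proof. exact: sqrtr_ge0. Qed.

Lemma l2norm0 : l2norm (0 : 'cV[C]_d) = 0.
Proof.
rewrite /l2norm big1 ?sqrtr0// => i _.
by rewrite mxE ComplexField.Normc.normc0 expr0n.
Qed.

Lemma l2normZ (c : C) v : l2norm (c *: v) = normc c * l2norm v.
Proof.
rewrite /l2norm -[X in X * _](ger0_norm (normc_ge0 c)) -sqrtr_sqr -sqrtrM ?sqr_ge0//.
congr Num.sqrt; rewrite mulr_sumr; apply: eq_bigr => i _.
by rewrite mxE ComplexField.Normc.normcM exprMn.
Qed.

Lemma l2normD u v : l2norm (u + v) <= l2norm u + l2norm v.
Proof.
rewrite -(@ler_pXn2r _ 2) ?nnegrE ?addr_ge0 ?l2norm_ge0// sqrrD !sqr_l2norm.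
apply: (@le_trans _ _ (\sum_(i < d) (normc (u i ord0) + normc (v i ord0)) ^+ 2)).
  apply: ler_sum => i _; rewrite ler_pXn2r ?nnegrE ?addr_ge0 ?normc_ge0//.
  by rewrite mxE; exact: le_normcD.
under eq_bigr do rewrite sqrrD.
rewrite !big_split /= lerD2r lerD2l.
by rewrite mulr2n lerD//; exact: sum_CauchySchwarz.
Qed.

Lemma l2norm_eq0 v : l2norm v = 0 -> v = 0.
Proof.
move=> /(congr1 (fun x => x ^+ 2)); rewrite sqr_l2norm expr0n /= => /eqP.
rewrite psumr_eq0 => [/allP h|i _]; last exact: sqr_ge0.
apply/matrixP => i j; rewrite ord1 mxE.
have := h i (mem_index_enum _).
by rewrite implyTb sqrf_eq0 => /eqP /ComplexField.Normc.eq0_normc.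
Qed.

Lemma normc_le_l2norm v i : normc (v i ord0) <= l2norm v.
Proof.
rewrite -(@ler_pXn2r _ 2) ?nnegrE ?l2norm_ge0 ?normc_ge0// sqr_l2norm.
by rewrite (bigD1 i)//= lerDl sumr_ge0// => j _; exact: sqr_ge0.
Qed.

(** A crude majorant: it bounds the set in [opnorm], so that [sup] is a genuine supremum, and later
    turns entrywise estimates into operator-norm ones. *)
Definition frobenius A : R :=
  Num.sqrt (\sum_(i < d) \sum_(j < d) normc (A i j) ^+ 2).

Lemma l2norm_mul_frobenius A v : l2norm (A *m v) <= frobenius A * l2norm v.
Proof.
rewrite -(@ler_pXn2r _ 2) ?nnegrE ?mulr_ge0 ?l2norm_ge0 ?sqrtr_ge0//.
rewrite exprMn sqr_l2norm sqr_sqrtr; last first.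
  by apply: sumr_ge0 => i _; apply: sumr_ge0 => j _; exact: sqr_ge0.
rewrite mulr_suml; apply: ler_sum => i _; rewrite mxE.
set s := \sum_(j < d) normc (A i j) ^+ 2.
have s0 : 0 <= s by apply: sumr_ge0 => j _; exact: sqr_ge0.
rewrite -[s]sqr_sqrtr// -exprMn ler_pXn2r ?nnegrE ?normc_ge0 ?mulr_ge0 ?sqrtr_ge0 ?l2norm_ge0//.
apply: le_trans (normc_sum _) _.
under eq_bigr do rewrite ComplexField.Normc.normcM.
exact: sum_CauchySchwarz.
Qed.

Lemma opnorm_has_sup A :
  has_sup [set l2norm (A *m v) | v in [set v : 'cV[C]_d | l2norm v <= 1]].
Proof.
split; first by exists (l2norm (A *m 0)), 0 => //=; rewrite l2norm0.
exists (frobenius A) => _ [v /= v1 <-]; apply: (le_trans (l2norm_mul_frobenius _ _)).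
by rewrite -[leRHS]mulr1 ler_wpM2l ?sqrtr_ge0.
Qed.

Lemma opnorm_ge0 A : 0 <= opnorm A.
Proof.
apply: (le_trans (l2norm_ge0 (A *m 0))); apply: ub_le_sup.
  exact: (opnorm_has_sup A).2.
by exists 0 => //=; rewrite l2norm0.
Qed.

Lemma l2norm_mul A v : l2norm (A *m v) <= opnorm A * l2norm v.
Proof.
have [v0|v0] := eqVneq (l2norm v) 0.
  by rewrite (l2norm_eq0 v0) mulmx0 l2norm0 mulr0.
have vp : 0 < l2norm v by rewrite lt_def v0 l2norm_ge0.
have nV : normc ((l2norm v)^-1)%:C = (l2norm v)^-1.
  by rewrite /= expr0n /= addr0 sqrtr_sqr ger0_norm ?invr_ge0 ?l2norm_ge0.
rewrite -ler_pdivrMr// mulrC -nV -l2normZ scalemxAr; apply: ub_le_sup.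
  exact: (opnorm_has_sup A).2.
by exists (((l2norm v)^-1)%:C *: v) => //=; rewrite l2normZ nV mulVf.
Qed.

Lemma opnorm_le A (c : R) :
  0 <= c -> (forall v, l2norm (A *m v) <= c * l2norm v) -> opnorm A <= c.
Proof.
move=> c0 h; apply: ge_sup; first exact: (opnorm_has_sup A).1.
by move=> _ [v /= v1 <-]; apply: (le_trans (h v)); rewrite -[leRHS]mulr1 ler_wpM2l.
Qed.

Lemma opnorm_le_frobenius A : opnorm A <= frobenius A.
Proof. by apply: opnorm_le (sqrtr_ge0 _) _ => v; exact: l2norm_mul_frobenius. Qed.

Lemma opnormD A B : opnorm (A + B) <= opnorm A + opnorm B.
Proof.
apply: opnorm_le => [|v]; first by rewrite addr_ge0 ?opnorm_ge0.
by rewrite mulmxDl mulrDl; apply: le_trans (l2normD _ _) (lerD _ _); exact: l2norm_mul.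
Qed.

Lemma opnormM A B : opnorm (A *m B) <= opnorm A * opnorm B.
Proof.
apply: opnorm_le => [|v]; first by rewrite mulr_ge0 ?opnorm_ge0.
rewrite -mulmxA -mulrA; apply: le_trans (l2norm_mul _ _) _.
by rewrite ler_wpM2l ?opnorm_ge0 ?l2norm_mul.
Qed.

Lemma opnorm_scale (c : C) A : opnorm (c *: A) <= normc c * opnorm A.
Proof.
apply: opnorm_le => [|v]; first by rewrite mulr_ge0 ?opnorm_ge0 ?normc_ge0.
by rewrite -scalemxAl l2normZ -mulrA ler_wpM2l ?normc_ge0 ?l2norm_mul.
Qed.

Lemma opnormN A : opnorm (- A) = opnorm A.
Proof.
have le B : opnorm (- B) <= opnorm B.
  rewrite -scaleN1r; apply: le_trans (opnorm_scale _ _) _.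
  by rewrite normcN ComplexField.Normc.normc1 mul1r.
by apply/eqP; rewrite eq_le le; have := le (- A); rewrite opprK.
Qed.

Lemma opnormB A B : opnorm (A - B) = opnorm (B - A).
Proof. by rewrite -opnormN opprB. Qed.

Lemma opnorm_triangle A B D : opnorm (A - D) <= opnorm (A - B) + opnorm (B - D).
Proof. by rewrite -(subrKA B A); exact: opnormD. Qed.

Lemma opnorm0 : opnorm (0 : 'M[C]_d) = 0.
Proof.
apply/eqP; rewrite eq_le opnorm_ge0 andbT; apply: opnorm_le => // v.
by rewrite mul0mx l2norm0 mul0r.
Qed.

Lemma opnorm_entry A i j : normc (A i j) <= opnorm A.
Proof.
have -> : A i j = (A *m delta_mx j (0 : 'I_1)) i ord0 by rewrite -colE mxE.
apply: le_trans (normc_le_l2norm _ _) _; apply: le_trans (l2norm_mul _ _) _.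
rewrite -[leRHS]mulr1 ler_wpM2l ?opnorm_ge0// -(@ler_pXn2r _ 2) ?nnegrE ?l2norm_ge0//.
rewrite sqr_l2norm expr1n (bigD1 j)//= big1 => [|k kj].
  by rewrite mxE !eqxx ComplexField.Normc.normc1 expr1n addr0.
by rewrite mxE (negbTE kj) ComplexField.Normc.normc0 expr0n.
Qed.

Lemma opnorm_diag (a : 'rV[C]_d) (c : R) :
  0 <= c -> (forall i, normc (a ord0 i) <= c) -> opnorm (diag_mx a) <= c.
Proof.
move=> c0 h; apply: opnorm_le => // v.
rewrite -(@ler_pXn2r _ 2) ?nnegrE ?mulr_ge0 ?l2norm_ge0//.
rewrite exprMn !sqr_l2norm mulr_sumr; apply: ler_sum => i _.
rewrite mul_diag_mx mxE ComplexField.Normc.normcM exprMn ler_wpM2r ?sqr_ge0//.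
by rewrite ler_pXn2r ?nnegrE ?normc_ge0.
Qed.

Lemma opnorm_scalar (c : C) : opnorm (c%:M : 'M[C]_d) <= normc c.
Proof.
by rewrite -diag_const_mx; apply: opnorm_diag (normc_ge0 _) _ => i; rewrite mxE.
Qed.

Lemma opnorm1 : opnorm (1%:M : 'M[C]_d) <= 1.
Proof. by rewrite -(ComplexField.Normc.normc1 R); exact: opnorm_scalar. Qed.

Lemma sqr_l2normE v : (l2norm v ^+ 2)%:C = (v^t* *m v) ord0 ord0.
Proof.
rewrite sqr_l2norm mxE rmorph_sum /=; apply: eq_bigr => i _.
by rewrite sqr_normcE !mxE.
Qed.

Lemma adj_mulmx (m n p : nat) (A : 'M[C]_(m, n)) (B : 'M[C]_(n, p)) :
  (A *m B)^t* = B^t* *m A^t*.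
Proof. by rewrite trmx_mul map_mxM. Qed.

Lemma unitarymxPl A : A \is unitarymx -> A^t* *m A = 1%:M.
Proof. by rewrite -trmxC_unitary => /unitarymxP; rewrite trmxCK. Qed.

Lemma l2norm_unitary A v : A \is unitarymx -> l2norm (A *m v) = l2norm v.
Proof.
move=> uA; apply/eqP; rewrite -(@eqrXn2 _ 2) ?l2norm_ge0//; apply/eqP.
apply: (@complexI R); rewrite !sqr_l2normE adj_mulmx mulmxA -(mulmxA _ (A^t*)) unitarymxPl//.
by rewrite mulmx1.
Qed.

Lemma opnorm_unitary A : A \is unitarymx -> opnorm A <= 1.
Proof. by move=> uA; apply: opnorm_le => // v; rewrite l2norm_unitary// mul1r. Qed.

Lemma opnorm_unitaryMl A B : A \is unitarymx -> opnorm (A *m B) <= opnorm B.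
Proof.
move=> uA; apply: le_trans (opnormM _ _) _.
by rewrite -[leRHS]mul1r ler_wpM2r ?opnorm_ge0 ?opnorm_unitary.
Qed.

Lemma opnorm_unitaryMr A B : A \is unitarymx -> opnorm (B *m A) <= opnorm B.
Proof.
move=> uA; apply: le_trans (opnormM _ _) _.
by rewrite -[leRHS]mulr1 ler_wpM2l ?opnorm_ge0 ?opnorm_unitary.
Qed.

Lemma opnorm_conj_unitary A B :
  A \is unitarymx -> opnorm (A *m B *m A^t*) <= opnorm B.
Proof.
move=> uA; have uA' : A^t* \is unitarymx by rewrite trmxC_unitary.
exact: le_trans (opnorm_unitaryMr _ uA') (opnorm_unitaryMl _ uA).
Qed.

End Vectors.
End OperatorNorm.

(** * Second-order expansion of the Weyl product *)

Definition quad_rem (R : realFieldType) (n : nat) (e : R) : R :=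
  (1 + e) ^+ n - 1 - n%:R * e.

Lemma quad_remS (R : realFieldType) n (e : R) :
  quad_rem n.+1 e = quad_rem n e * (1 + e) + n%:R * e ^+ 2.
Proof. rewrite /quad_rem exprS -natr1; ring. Qed.

Lemma quad_rem_ge0 (R : realFieldType) n (e : R) : 0 <= e -> 0 <= quad_rem n e.
Proof.
move=> e0; elim: n => [|n IH].
  by rewrite /quad_rem expr0 mul0r subrr subr0.
rewrite quad_remS; apply: addr_ge0; apply: mulr_ge0; rewrite ?sqr_ge0//.
by rewrite addr_ge0.
Qed.

Lemma quad_rem_le_pow2 (R : realFieldType) n (e : R) :
  0 <= e -> e <= 1 -> quad_rem n e <= 2 ^+ n * e ^+ 2.
Proof.
move=> e0 e1.
(* The coefficient is [quad_rem n 1]; unlike the bare power of 2, it satisfies the recurrence of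
   [quad_remS] exactly. *)
suff : quad_rem n e <= (2 ^+ n - 1 - n%:R) * e ^+ 2.
  move=> /le_trans; apply; rewrite ler_wpM2r ?sqr_ge0// -addrA gerDl -opprD.
  by rewrite oppr_le0 addr_ge0 ?ler01.
elim: n => [|n IH].
  by rewrite /quad_rem expr0 mul0r subrr !subr0 mul0r.
have q0 := quad_rem_ge0 n e0.
rewrite quad_remS.
apply: (@le_trans _ _ (quad_rem n e * 2 + n%:R * e ^+ 2)).
  by rewrite lerD2r ler_wpM2l//; lra.
apply: (@le_trans _ _ ((2 ^+ n - 1 - n%:R) * e ^+ 2 * 2 + n%:R * e ^+ 2)).
  by rewrite lerD2r ler_wpM2r.
by rewrite [2 ^+ n.+1]exprS -[n.+1%:R]natr1 le_eqVlt; apply/orP; left; apply/eqP; ring.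
Qed.

(** The leading coefficient is 1/2; 11/20 leaves room for the higher terms. The induction closes
    because 11/20 * 9/50 <= 2 * (11/20) - 1. *)
Lemma quad_rem_le_sqr (R : realFieldType) n (e : R) : 0 <= e ->
  n%:R * e <= 9 / 50 -> quad_rem n e <= 11 / 20 * (n%:R * e) ^+ 2.
Proof.
move=> e0; elim: n => [|n IH] ne.
  by rewrite /quad_rem expr0 mul0r subrr subr0 expr0n /= mulr0.
have ne' : n%:R * e <= 9 / 50.
  by apply: le_trans ne; rewrite ler_wpM2r// ler_nat.
rewrite quad_remS.
apply: (@le_trans _ _ (11 / 20 * (n%:R * e) ^+ 2 * (1 + e) + n%:R * e ^+ 2)).
  by rewrite lerD2r ler_wpM2r ?IH// addr_ge0.
rewrite -natr1.
have : 0 <= n%:R * e ^+ 2 * (9 / 50 - n%:R * e) by rewrite mulr_ge0 ?mulr_ge0 ?sqr_ge0// subr_ge0.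
have : 0 <= n%:R * e ^+ 2 :> R by rewrite mulr_ge0 ?sqr_ge0.
have := sqr_ge0 e.
nra.
Qed.

Section NearOne.
Variables (R : realFieldType) (A : pzRingType) (N : A -> R).
Hypothesis N_ge0 : forall x, 0 <= N x.
Hypothesis ND : forall x y, N (x + y) <= N x + N y.
Hypothesis NM : forall x y, N (x * y) <= N x * N y.
Hypothesis N0 : N 0 = 0.
Hypothesis N1 : N 1 <= 1.

(** P behaves like a product of n factors within e of 1 with linear part S. Ring and norm are
    abstract because this serves twice: for matrices in the Weyl product and for eigenvalues in the
    trace bound. Assuming only [N 1 <= 1] covers matrices of size 0. *)
Definition near_one (e : R) (n : nat) (P S : A) : Prop :=
  N (P - 1 - S) <= quad_rem n e /\ N S <= n%:R * e.

Lemma near_one1 e : near_one e 0 1 0.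
Proof.
by split; rewrite /quad_rem ?expr0 !(mul0r, subrr, subr0) N0.
Qed.

Lemma near_one_factor e E : N E <= e -> near_one e 1 (1 + E) E.
Proof.
move=> Ee; split; last by rewrite mul1r.
rewrite [1 + E]addrC addrK subrr N0 quad_rem_ge0//.
exact: le_trans (N_ge0 _) Ee.
Qed.

Lemma near_oneM e n m P S Q T : 0 <= e ->
  near_one e n P S -> near_one e m Q T -> near_one e (n + m) (P * Q) (S + T).
Proof.
move=> e0 [hP hS] [hQ hT]; split; last first.
  by apply: le_trans (ND _ _) _; rewrite natrD mulrDl lerD.
set x := P - 1 - S in hP; set y := Q - 1 - T in hQ.
(* An identity respecting the order of factors; once norms are replaced by their bounds, the
   right-hand side becomes exactly [quad_rem (n + m) e]. *)
have -> : P * Q - 1 - (S + T) = S * T + x * (1 + T + y) + (1 + S) * y.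
  have PE : P = 1 + S + x by rewrite [RHS]addrC [1 + S]addrC addrA /x !subrK.
  have QE : Q = 1 + T + y by rewrite [RHS]addrC [1 + T]addrC addrA /y !subrK.
  have -> : P * Q = S * T + x * Q + (1 + S) * y + (S + T) + 1.
    rewrite [in LHS]PE mulrDl {1}QE mulrDr mulrDl mul1r mulrDr mulr1.
    by rewrite (AC ((2*2)*1*1)%AC (4*6*5*(3*2)*1)%AC).
  by rewrite !addrK -QE.
have q0 := quad_rem_ge0 n e0; have r0 := quad_rem_ge0 m e0.
have ne0 : 0 <= n%:R * e by rewrite mulr_ge0.
have me0 : 0 <= m%:R * e by rewrite mulr_ge0.
apply: (@le_trans _ _ (n%:R * e * (m%:R * e) +
   quad_rem n e * (1 + m%:R * e + quad_rem m e) +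
   (1 + n%:R * e) * quad_rem m e)).
  apply: le_trans (ND _ _) _; apply: lerD.
    apply: le_trans (ND _ _) _; apply: lerD.
      by apply: le_trans (NM _ _) _; apply: ler_pM.
    apply: le_trans (NM _ _) _; apply: ler_pM => //.
    apply: le_trans (ND _ _) _; apply: lerD => //.
    by apply: le_trans (ND _ _) _; apply: lerD.
  apply: le_trans (NM _ _) _; apply: ler_pM => //.
  by apply: le_trans (ND _ _) _; apply: lerD.
rewrite /quad_rem natrD exprD le_eqVlt; apply/orP; left; apply/eqP; ring.
Qed.

Lemma near_one_prod e (m : nat) (n : 'I_m -> nat) (P S : 'I_m -> A) : 0 <= e ->
  (forall i, near_one e (n i) (P i) (S i)) ->
  near_one e (\sum_i n i) (\prod_i P i) (\sum_i S i).
Proof.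
move=> e0 h; apply: (big_ind3 (near_one e)) => //; first exact: near_one1.
by move=> *; exact: near_oneM.
Qed.

End NearOne.

Section Twirl.
Variable R : realType.
Local Notation C := R[i].
Local Notation normc := (@ComplexField.Normc.normc R).

Lemma near_one_mx_prod d (e : R) (m : nat) (n : 'I_m -> nat) (P S : 'I_m -> 'M[C]_d) :
  0 <= e -> (forall i, near_one (@opnorm R d) e (n i) (P i) (S i)) ->
  near_one (@opnorm R d) e (\sum_i n i) (\prod_i P i) (\sum_i S i).
Proof.
apply: near_one_prod.
- exact: opnorm_ge0.
- exact: opnormD.
- exact: opnormM.
- exact: opnorm0.
- exact: opnorm1.
Qed.

Lemma near_one_normc_prod (e : R) (m : nat) (n : 'I_m -> nat) (P S : 'I_m -> C) :
  0 <= e -> (forall i, near_one normc e (n i) (P i) (S i)) ->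
  near_one normc e (\sum_i n i) (\prod_i P i) (\sum_i S i).
Proof.
apply: near_one_prod.
- exact: normc_ge0.
- exact: le_normcD.
- by move=> x y; rewrite ComplexField.Normc.normcM.
- exact: ComplexField.Normc.normc0.
- by rewrite ComplexField.Normc.normc1.
Qed.

Lemma val_iter_ord_pred d a (i : 'I_d) : (a <= d)%N ->
  iter a (@ord_pred d) i = ((i + (d - a)) %% d)%N :> nat.
Proof.
elim: a => [|a IH] ad; first by rewrite subn0 modnDr modn_small.
have d0 : (0 < d)%N by exact: leq_ltn_trans ad.
rewrite iterS /= IH 1?ltnW//.
have -> x : ((x + d).-1 = x + d.-1)%N by lia.
rewrite modnDml -(modnDr (_ + (d - a.+1))); congr (_ %% _)%N; lia.
Qed.

(** Shifting i by all a in 'I_d meets every index once, so products and sums over shifts reindex to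
    products and sums over all entries. *)
Lemma iter_ord_pred_inj d (i : 'I_d) :
  injective (fun a : 'I_d => iter a (@ord_pred d) i).
Proof.
move=> a b /(congr1 (@nat_of_ord d)).
rewrite !val_iter_ord_pred 1?ltnW// => /eqP; rewrite eqn_modDl => /eqP ab.
apply: val_inj => /=; move: a b ab => [a la] [b lb] /=.
case: a la => [|a] la; case: b lb => [|b] lb //=.
- by rewrite subn0 modnn modn_small; lia.
- by rewrite subn0 modnn modn_small; lia.
- by rewrite !modn_small; lia.
Qed.

Lemma weylX_conj d (M : 'M[C]_d) i j :
  (weylX R d *m M *m (weylX R d)^t*) i j = M (ord_pred i) (ord_pred j).
Proof.
rewrite mxE (bigD1 (ord_pred j)) //= big1 ?addr0 => [|k kj].
  rewrite !mxE ord_predK eqxx rmorph1 mulr1.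
  rewrite (bigD1 (ord_pred i)) //= big1 ?addr0 => [|k ki].
    by rewrite !mxE ord_predK eqxx mul1r.
  rewrite !mxE; case: eqP => [ik|_]; last by rewrite mul0r.
  by move: ki; rewrite ik ordSK eqxx.
rewrite !mxE; case: eqP => [jk|_]; last by rewrite rmorph0 mulr0.
by move: kj; rewrite jk ordSK eqxx.
Qed.

Lemma weylXn_conj d (M : 'M[C]_d) a i j :
  (weylX R d ^+ a *m M *m (weylX R d ^+ a)^t*) i j =
  M (iter a (@ord_pred d) i) (iter a (@ord_pred d) j).
Proof.
elim: a M i j => [|a IH] M i j.
  by rewrite expr0 trmx1 map_mx1 mulmx1 mul1mx.
rewrite exprSr [_ * _](erefl (_ *m _)) adj_mulmx.
have -> (A B E F : 'M[C]_d) : A *m B *m M *m (E *m F) = A *m (B *m M *m E) *m F.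
  by rewrite !mulmxA.
by rewrite IH weylX_conj !iterS.
Qed.

Lemma diag_mx_exp d (v : 'rV[C]_d) n :
  diag_mx v ^+ n = diag_mx (\row_j v ord0 j ^+ n).
Proof.
elim: n => [|n IH].
  rewrite expr0 -[1]/(1%:M) -diag_const_mx; congr diag_mx.
  by apply/rowP => j; rewrite !mxE.
rewrite exprS IH [_ * _](erefl (_ *m _)) mulmx_diag; congr diag_mx.
by apply/rowP => j; rewrite !mxE exprS.
Qed.

Lemma diag_conj d (v : 'rV[C]_d) (M : 'M[C]_d) i j :
  (diag_mx v *m M *m (diag_mx v)^t*) i j = v ord0 i * (v ord0 j)^*%R * M i j.
Proof.
rewrite tr_diag_mx map_diag_mx mul_mx_diag mxE mul_diag_mx mxE mxE mulrAC.
by rewrite mulrAC.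
Qed.

Lemma omegaX d n :
  omega R d ^+ n = cos (2 * pi / d%:R *+ n) +i* sin (2 * pi / d%:R *+ n).
Proof.
rewrite /omega; set t := 2 * pi / d%:R.
elim: n => [|n IH]; first by rewrite expr0 mulr0n cos0 sin0.
rewrite exprS IH [t *+ n.+1]mulrS cosD sinD.
by apply/eqP; rewrite eq_complex /=; apply/andP; split; apply/eqP; ring.
Qed.

Lemma omega_expr_order d : (0 < d)%N -> omega R d ^+ d = 1.
Proof.
move=> d0; rewrite omegaX -mulr_natr divfK ?pnatr_eq0 -?lt0n//.
by rewrite mulrC mulr_natr cos2pi sin2pi.
Qed.

Lemma omega_expr_neq1 d n : (0 < n < d)%N -> omega R d ^+ n != 1.
Proof.
move=> /andP[n0 nd]; rewrite omegaX; apply/eqP => -[c1 _].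
have d0 : 0 < d%:R :> R by rewrite ltr0n (ltn_trans n0).
(* The half angle lies strictly between 0 and pi, where sin is positive, whereas cos (x + x) = 1
   forces sin x = 0. *)
pose x : R := pi / d%:R *+ n.
have xE : 2 * pi / d%:R *+ n = x *+ 2.
  by rewrite /x -mulrnA mulnC mulrnA; congr (_ *+ n); rewrite mulr2n; ring.
have x_pos : 0 < sin x.
  apply: sin_gt0_pi; rewrite /x pmulrn_lgt0// divr_gt0 ?pi_gt0//=.
  rewrite -mulr_natr mulrAC ltr_pdivrMr// ltr_pM2l ?pi_gt0//.
  by rewrite ltr_nat.
move: c1; rewrite xE mulr2n cosD => c1; have := cos2Dsin2 x; nra.
Qed.

Lemma omega_expr_inj d (i j : 'I_d) : omega R d ^+ i = omega R d ^+ j -> i = j.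
Proof.
have wi k : omega R d ^+ k != 0.
  rewrite expf_neq0//; apply/eqP => w0; have := omega_norm R d.
  by rewrite w0 mul0r => /eqP; rewrite eq_sym oner_eq0.
wlog ij : i j / (i <= j)%N => [hw eij|].
  by case: (leqP i j) => [/hw|/ltnW /hw ->//]; exact.
rewrite -[in omega R d ^+ j](subnK ij) exprD -{1}[omega R d ^+ i]mul1r => /(mulIf (wi _)) h.
apply/val_inj/eqP; rewrite eqn_leq ij leqNgt; apply/negP => lt_ij.
move/eqP: h; rewrite eq_sym; apply/negP/omega_expr_neq1.
by rewrite subn_gt0 lt_ij (leq_ltn_trans (leq_subr _ _)).
Qed.

(** Conjugation by the powers of Z multiplies entry (i, j) by the powers of a d-th root of unity,
    which is 1 only for i = j; elsewhere the geometric sum vanishes. *)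
Lemma weylZ_sum d (M : 'M[C]_d) :
  \sum_(a < d) weylZ R d ^+ a *m M *m (weylZ R d ^+ a)^t* =
  d%:R *: diag_mx (\row_j M j j).
Proof.
apply/matrixP => i j; rewrite summxE.
pose z := omega R d ^+ i * (omega R d ^+ j)^*%R.
under eq_bigr => a _.
  rewrite /weylZ diag_mx_exp diag_conj !mxE.
  rewrite [_ ^+ a * _](_ : _ = z ^+ a); last first.
    by rewrite exprMn rmorphXn.
  over.
rewrite -mulr_suml !mxE eq_sym.
have zE : (z == 1) = (i == j).
  have nj : omega R d ^+ j * (omega R d ^+ j)^*%R = 1.
    by rewrite rmorphXn -exprMn omega_norm expr1n.
  apply/eqP/eqP => [z1|ij]; last by rewrite /z ij nj.
  apply: omega_expr_inj; by rewrite -[LHS]mulr1 -nj mulrCA -/z z1 mulr1.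
case: (eqVneq i j) zE => [<- /eqP ->|ij /negbT z1].
  under eq_bigr do rewrite expr1n.
  by rewrite sumr_const card_ord mulr1n.
have d0 : (0 < d)%N by exact: leq_ltn_trans (ltn_ord i).
have zd : z ^+ d = 1.
  by rewrite exprMn rmorphXn -!exprM ![(_ * d)%N]mulnC !exprM -rmorphXn
     omega_expr_order// !expr1n rmorph1 expr1n mulr1.
have := subrX1 z d; rewrite zd subrr => /esym/eqP; rewrite mulf_eq0 subr_eq0.
by rewrite (negbTE z1) /= => /eqP ->; rewrite mul0r mulr0n mulr0.
Qed.

Lemma conj_unitary_prod d (S : 'M[C]_d) m (F : 'I_m -> 'M[C]_d) :
  S \is unitarymx ->
  \prod_(i < m) (S *m F i *m S^t*) = S *m (\prod_(i < m) F i) *m S^t*.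
Proof.
move=> uS; elim: m F => [|m IH] F.
  by rewrite !big_ord0 -[1]/(1%:M) mulmx1; apply/esym/unitarymxP.
rewrite !big_ord_recr /= IH [X in _ = _ *m X *m _](erefl (_ *m _)).
rewrite [LHS](erefl (_ *m _)) !mulmxA.
by rewrite -(mulmxA _ (S^t*) S) (unitarymxPl uS) mulmx1.
Qed.

(** The step that collects the unperturbed factors on the right: moving q, the unperturbed product
    so far, past the perturbation conjugates E by q X, which keeps its norm under control. *)
Lemma conj_perturb d (p q X D E : 'M[C]_d) :
  X \is unitarymx -> q \is unitarymx -> q = p *m (X *m D *m X^t*) ->
  p *m (X *m (D *m (1%:M + E)) *m X^t*) =
  (1%:M + (q *m X) *m E *m (q *m X)^t*) *m q.
Proof.
move=> uX uq qE; rewrite [RHS]mulmxDl mul1mx adj_mulmx.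
rewrite -[in RHS](mulmxA _ _ q) -(mulmxA _ _ q) unitarymxPl// mulmx1 {}qE.
rewrite mulmxDr mulmx1 mulmxDr mulmxDl mulmxDr; congr (_ + _).
by rewrite !mulmxA -(mulmxA _ (X^t*) X) (unitarymxPl uX) mulmx1.
Qed.

Section DiagonalPerturbation.
Variables (d : nat) (delta : 'rV[C]_d).
Hypothesis delta_norm : forall j, normc (delta ord0 j) = 1.
Hypothesis delta_prod : \prod_j delta ord0 j = 1.

(** The diagonal of the product of the first n shifted copies of [diag_mx delta]. In this section
    [delta] is a unimodular diagonal, not the constant of the theorem. *)
Definition shift_prod (n : nat) : 'rV[C]_d :=
  \row_i \prod_(b < n) delta ord0 (iter b (@ord_pred d) i).

Lemma shift_prod_norm n i : normc (shift_prod n ord0 i) = 1.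
Proof.
rewrite mxE; elim/big_rec: _ => [|b y _ IH]; first exact: ComplexField.Normc.normc1.
by rewrite ComplexField.Normc.normcM delta_norm IH mulr1.
Qed.

Lemma shift_prod_unitary n : diag_mx (shift_prod n) \is unitarymx.
Proof.
apply/unitarymxP/matrixP => i j.
rewrite -[X in X *m _]mulmx1 diag_conj !mxE.
case: eqVneq => [<-|_]; last by rewrite mulr0.
by rewrite mulr1 mulrC; apply/eqP; rewrite -unit_normc -{1}(shift_prod_norm n i) mxE.
Qed.

Lemma shift_prodS n :
  diag_mx (shift_prod n.+1) =
  diag_mx (shift_prod n) *m
  (weylX R d ^+ n *m diag_mx delta *m (weylX R d ^+ n)^t*).
Proof.
apply/matrixP => i j; rewrite mul_diag_mx [RHS]mxE weylXn_conj !mxE big_ord_recr /=.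
case: (eqVneq i j) => [<-|ij]; first by rewrite eqxx !mulr1n.
rewrite mulr0n; case: eqP; rewrite ?mulr0n ?mulr0// => h.
by move: ij; rewrite (_ : i = j) ?eqxx//; elim: n h => //= n IH /(can_inj (@ord_predK d)).
Qed.

(** Over a full cycle each entry is the product of all entries of [delta], that is, the determinant.
    This is why diagonal members of SU(d) are sent exactly to 1. *)
Lemma shift_prod_full : diag_mx (shift_prod d) = 1%:M.
Proof.
rewrite -diag_const_mx; congr diag_mx; apply/rowP => i; rewrite !mxE.
rewrite -[RHS]delta_prod; apply/esym.
exact: (reindex_inj (P := xpredT) (F := fun j => delta ord0 j) (@iter_ord_pred_inj d i)).
Qed.

Lemma prod_shift_conj (E : 'M[C]_d) n :
  \prod_(a < n) (weylX R d ^+ a *m (diag_mx delta *m (1%:M + E)) *m (weylX R d ^+ a)^t*) =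
  (\prod_(a < n) (1%:M + (diag_mx (shift_prod a.+1) *m weylX R d ^+ a) *m E *m
     (diag_mx (shift_prod a.+1) *m weylX R d ^+ a)^t*))
  *m diag_mx (shift_prod n).
Proof.
elim: n => [|n IH].
  rewrite !big_ord0 -[1]/(1%:M) mul1mx -diag_const_mx; congr diag_mx.
  by apply/rowP => i; rewrite !mxE big_ord0.
rewrite !big_ord_recr /= {}IH ![_ * _](erefl (_ *m _)) -[LHS]mulmxA -[RHS]mulmxA.
congr (_ *m _); apply: conj_perturb.
- by apply/exp_unitary/weylX_unitary.
- exact: shift_prod_unitary.
- exact: shift_prodS.
Qed.

(** For fixed a1, Z^a1 conjugates the whole inner product, whose unperturbed part is 1 by
    [shift_prod_full]. What is left is d * d factors, each 1 plus a unitary conjugate of E. *)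
Lemma weyl_twirl_near_one (E : 'M[C]_d) :
  near_one (@opnorm R d) (opnorm E) (d * d)
    (weyl_twirl (diag_mx delta *m (1%:M + E))) ((d%:R * \tr E)%:M).
Proof.
pose T (a2 : nat) := diag_mx (shift_prod a2.+1) *m weylX R d ^+ a2.
pose Z a1 := weylZ R d ^+ a1.
have uX a : weylX R d ^+ a \is unitarymx by apply/exp_unitary/weylX_unitary.
have uZ a : Z a \is unitarymx by apply/exp_unitary/weylZ_unitary.
have uT a : T a \is unitarymx by rewrite mul_unitarymx ?shift_prod_unitary.
have -> : weyl_twirl (diag_mx delta *m (1%:M + E)) =
  \prod_(a1 < d) \prod_(a2 < d) (1%:M + Z a1 *m (T a2 *m E *m (T a2)^t*) *m (Z a1)^t*).
  apply: eq_bigr => a1 _.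
  transitivity (Z a1 *m (\prod_(a2 < d) (1%:M + T a2 *m E *m (T a2)^t*)) *m (Z a1)^t*).
    have := prod_shift_conj E d; rewrite shift_prod_full mulmx1 => <-.
    rewrite -conj_unitary_prod//; apply: eq_bigr => a2 _.
    by rewrite /weyl adj_mulmx !mulmxA.
  rewrite -conj_unitary_prod//; apply: eq_bigr => a2 _.
  by rewrite mulmxDr mulmx1 mulmxDl; congr (_ + _); apply/unitarymxP.
have -> : (d%:R * \tr E)%:M =
  \sum_(a1 < d) \sum_(a2 < d) Z a1 *m (T a2 *m E *m (T a2)^t*) *m (Z a1)^t*.
  (* The sum over a1 keeps d times the diagonal of the conjugate of E by [T a2]. The diagonal
     unitary in [T] does not affect diagonal entries, and the shifts run through the trace. *)
  rewrite exchange_big /=; under eq_bigr do rewrite weylZ_sum.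
  rewrite -scaler_sumr -scale_scalar_mx; congr (_ *: _).
  apply/matrixP => i j; rewrite summxE.
  under eq_bigr => a _.
    rewrite mxE mxE /T adj_mulmx.
    have -> (A B F G : 'M[C]_d) : A *m B *m E *m (F *m G) = A *m (B *m E *m F) *m G.
      by rewrite !mulmxA.
    rewrite diag_conj weylXn_conj mulrC [X in _ * X](_ : _ = 1) ?mulr1; last first.
      by rewrite mulrC; apply/eqP; rewrite -unit_normc shift_prod_norm.
    over.
  rewrite mxE /= sumrMnl /mxtrace; congr (_ *+ _).
  exact: (reindex_inj (P := xpredT) (F := fun j => E j j) (@iter_ord_pred_inj d i)).
have -> : (d * d)%N = (\sum_(a1 < d) \sum_(a2 < d) 1)%N.
  by rewrite !sum_nat_const card_ord muln1.
apply: near_one_mx_prod => [|a1]; first exact: opnorm_ge0.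
apply: near_one_mx_prod => [|a2]; first exact: opnorm_ge0.
apply: near_one_factor; first exact: opnorm_ge0.
  exact: opnorm0.
exact: le_trans (opnorm_conj_unitary _ (uZ a1)) (opnorm_conj_unitary _ (uT a2)).
Qed.

End DiagonalPerturbation.

Lemma unitary_spectral d (U : 'M[C]_d) : U \is unitarymx ->
  exists (P : 'M[C]_d) (lam : 'rV[C]_d),
    [/\ P \is unitarymx, U = P^t* *m diag_mx lam *m P &
        forall j, normc (lam ord0 j) = 1].
Proof.
move=> uU; have nU : U \is normalmx.
  by apply/normalmxP; rewrite unitarymxPl//; apply/unitarymxP.
have uP := spectral_unitarymx U.
have UE := orthomx_spectralP nU; rewrite invmx_unitary// in UE.
exists (spectralmx U), (spectral_diag U); split=> // j.
move: UE; set P := spectralmx U; set l := spectral_diag U => UE.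
have lE : diag_mx l = P *m U *m P^t*.
  by rewrite [X in _ *m X *m _]UE !mulmxA (unitarymxP uP) mul1mx -mulmxA (unitarymxP uP) mulmx1.
have : diag_mx l \is unitarymx by rewrite lE conj_unitary.
move/unitarymxPl/matrixP/(_ j j).
rewrite tr_diag_mx map_diag_mx mulmx_diag !mxE eqxx !mulr1n => h.
by apply/eqP; rewrite unit_normc h.
Qed.

(** Expand the product of the eigenvalues 1 + (l_j - 1): since it equals 1, its linear term, the
    trace, is minus its second-order remainder. *)
Lemma trace_bound d (U : 'M[C]_d) : U \is unitarymx -> \det U = 1 ->
  normc (\tr (U - 1%:M)) <= quad_rem d (opnorm (U - 1%:M)).
Proof.
move=> uU dU; have [P [l [uP UE nl]]] := unitary_spectral uU.
have PP := unitarymxPl uP; have PP' := unitarymxP uP.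
have lE : P *m (U - 1%:M) *m P^t* = diag_mx (\row_j (l ord0 j - 1)).
  rewrite mulmxBr mulmx1 mulmxBl PP' UE !mulmxA PP' mul1mx -mulmxA PP' mulmx1.
  rewrite -diag_const_mx -raddfB /=; congr diag_mx; by apply/rowP => j; rewrite !mxE.
have tE : \tr (U - 1%:M) = \sum_j (l ord0 j - 1).
  have -> : \tr (U - 1%:M) = \tr (P *m (U - 1%:M) *m P^t*).
    by rewrite mxtrace_mulC mulmxA PP mul1mx.
  by rewrite lE mxtrace_diag; apply: eq_bigr => j _; rewrite mxE.
have pl : \prod_j l ord0 j = 1.
  rewrite -det_diag -dU UE !det_mulmx mulrAC -det_mulmx PP det1 mul1r//.
have := @near_one_normc_prod (opnorm (U - 1%:M)) d (fun=> 1%N) (fun j => 1 + (l ord0 j - 1))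
  (fun j => l ord0 j - 1) (opnorm_ge0 _).
rewrite sum_nat_const card_ord muln1 -tE => -[i|h _].
- apply: near_one_factor; first exact: normc_ge0.
    exact: ComplexField.Normc.normc0.
  have -> : l ord0 i - 1 = (P *m (U - 1%:M) *m P^t*) i i by rewrite lE !mxE eqxx mulr1n.
  exact: le_trans (opnorm_entry _ _ _) (opnorm_conj_unitary _ uP).
- move: h; rewrite (eq_bigr (fun j => l ord0 j)); last by move=> j _; rewrite addrC subrK.
  by rewrite pl subrr sub0r normcN.
Qed.

Lemma unitary_factor d (D Y : 'M[C]_d) : D \is unitarymx ->
  exists E, [/\ Y = D *m (1%:M + E), E = D^t* *m Y - 1%:M &
    opnorm (Y - D) = opnorm E].
Proof.
move=> uD; have uD' : D^t* \is unitarymx by rewrite trmxC_unitary.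
have DD := unitarymxPl uD; have DD' := unitarymxP uD.
exists (D^t* *m (Y - D)); split.
- by rewrite mulmxDr mulmx1 mulmxA DD' mul1mx addrC subrK.
- by rewrite mulmxBr DD.
- apply: le_anti; apply/andP; split; last exact: opnorm_unitaryMl uD'.
  have -> : opnorm (Y - D) = opnorm (D *m (D^t* *m (Y - D))).
    by rewrite mulmxA DD' mul1mx.
  exact: opnorm_unitaryMl uD.
Qed.

Lemma weyl_twirl_diag_bound d (delta : 'rV[C]_d) (Y : 'M[C]_d) :
  (forall j, normc (delta ord0 j) = 1) -> \prod_j delta ord0 j = 1 ->
  Y \is unitarymx -> \det Y = 1 ->
  opnorm (weyl_twirl Y - 1%:M) <=
  d%:R * quad_rem d (opnorm (Y - diag_mx delta)) +
  quad_rem (d ^ 2) (opnorm (Y - diag_mx delta)).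
Proof.
move=> nd pd uY dY; set D := diag_mx delta.
have uD : D \is unitarymx.
  apply/unitarymxP; rewrite tr_diag_mx map_diag_mx mulmx_diag -diag_const_mx.
  congr diag_mx; apply/rowP => j; rewrite !mxE mulrC; apply/eqP.
  by rewrite -unit_normc nd.
have [E [YE EE ->]] := unitary_factor Y uD.
have [h _] := weyl_twirl_near_one nd pd E.
rewrite -/D -YE in h.
have dD : \det D = 1 by rewrite det_diag.
have dD' : \det (D^t*) = 1 by rewrite det_map_mx det_tr dD rmorph1.
have ht : normc (\tr E) <= quad_rem d (opnorm E).
  rewrite EE; apply: trace_bound; last by rewrite det_mulmx dD' dY mulr1.
  by apply: mul_unitarymx uY; rewrite trmxC_unitary.
rewrite -(subrK ((d%:R * \tr E)%:M) (weyl_twirl Y - 1%:M)) addrC.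
apply: le_trans (opnormD _ _) _; apply: lerD; last by rewrite expnS expn1.
apply: le_trans (opnorm_scalar _ _) _.
rewrite ComplexField.Normc.normcM; apply: ler_pM => //; rewrite ?normc_ge0//.
by rewrite -[X in normc X](rmorph_nat (@real_complex_def R (Phant R))) /= expr0n addr0 sqrtr_sqr ger0_norm.
Qed.
End Twirl.

(** * Contraction and landing *)

Section Dynamics.
Variable R : realType.
Local Notation C := R[i].
Local Notation normc := (@ComplexField.Normc.normc R).

Lemma su_unitary d (U : SU R d) : su_val U \is unitarymx.
Proof. by case: U => U /= /andP[]. Qed.

Lemma su_det d (U : SU R d) : \det (su_val U) = 1.
Proof. by case: U => U /= /andP[_ /eqP]. Qed.

Lemma alpha_ge1 d : 1 <= alpha R d.
Proof. by rewrite exprn_ege1// ler1n. Qed.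

Lemma alpha_gt0 d : 0 < alpha R d.
Proof. exact: lt_le_trans ltr01 (alpha_ge1 d). Qed.

Lemma opnorm_su_g d (V U : SU R d) :
  opnorm (su_val (su_g V U) - 1%:M) <= opnorm (su_val U - 1%:M).
Proof.
have uV := su_unitary V.
have -> : su_val (su_g V U) - 1%:M =
    su_val V *m (su_val U - 1%:M) *m (su_val V)^t*.
  by rewrite mulmxBr mulmx1 mulmxBl (unitarymxP uV).
exact: opnorm_conj_unitary.
Qed.

Lemma mul_exp2_le d : (2 <= d)%N -> (d * 2 ^ d <= 2 ^ (d ^ 2))%N.
Proof.
move=> d2; apply: (@leq_trans (2 ^ d * 2 ^ d)).
  by apply: leq_mul => //; apply: ltnW; exact: ltn_expl.
rewrite -expnD leq_exp2l//; nia.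
Qed.

Lemma su_f_contraction d (U : SU R d) : (2 <= d)%N ->
  opnorm (su_val U - 1%:M) <= 1 ->
  opnorm (su_val (su_f U) - 1%:M) <= alpha R d * opnorm (su_val U - 1%:M) ^+ 2.
Proof.
move=> d2 x1; set x := opnorm _ in x1 *.
have x0 : 0 <= x by exact: opnorm_ge0.
have := @weyl_twirl_diag_bound R d (const_mx 1) (su_val U) _ _ (su_unitary U) (su_det U).
rewrite diag_const_mx -/x => h.
apply: le_trans (h _ _) _ => [j||].
- by rewrite mxE ComplexField.Normc.normc1.
- by rewrite big1// => j _; rewrite mxE.
(* The origin of [alpha]: as d * 2^d <= 2^(d^2), the two coefficients add up to at most 2^(d^2 +
   1). *)
apply: (@le_trans _ _ (d%:R * (2 ^+ d * x ^+ 2) + 2 ^+ (d ^ 2) * x ^+ 2)).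
  by rewrite lerD ?ler_wpM2l// quad_rem_le_pow2.
rewrite mulrA -mulrDl ler_wpM2r ?sqr_ge0//.
rewrite /alpha addn1 [2 ^+ _.+1]exprS mulrDl mul1r lerD2r.
rewrite -!natrX -natrM ler_nat.
exact: mul_exp2_le.
Qed.

(** The region a x <= 1/4 is stable under z <= a y^2, and with a >= 1 it lies inside x <= 1, where
    the contraction estimate is available. *)
Lemma quadratic_step (a x : R) : 1 <= a -> 0 <= x -> a * x <= 4^-1 ->
  x <= 1 /\ forall y z, 0 <= y -> y <= x -> z <= a * y ^+ 2 ->
    a * z <= (a * x) ^+ 2 /\ a * z <= 4^-1.
Proof.
move=> a1 x0 ax; split=> [|y z y0 yx zy]; first by nra.
have a0 : 0 < a by lra.
have ax0 : 0 <= a * x by rewrite mulr_ge0// ltW.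
have az : a * z <= (a * x) ^+ 2.
  have yx2 : y ^+ 2 <= x ^+ 2 by rewrite lerXn2r.
  rewrite exprMn expr2 -mulrA ler_pM2l//; apply: le_trans zy _.
  by rewrite ler_pM2l.
by split=> //; apply: le_trans az _; nra.
Qed.

Lemma exprn_pow2_le (z w : R) n : 0 <= z -> z <= w ^+ 2 ->
  z ^+ (2 ^ n) <= w ^+ (2 ^ n.+1).
Proof.
move=> z0 zw; rewrite expnS exprM; apply: lerXn2r zw; rewrite nnegrE//.
exact: sqr_ge0.
Qed.

(** Valid for every sequence of draws: conjugation does not increase the distance to 1, and each
    twirl at least squares [alpha] times that distance. *)
Lemma su_F_contraction d (Vs : seq (SU R d)) (U : SU R d) : (2 <= d)%N ->
  alpha R d * opnorm (su_val U - 1%:M) <= 4^-1 ->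
  alpha R d * opnorm (su_val (su_F Vs U) - 1%:M) <=
  (alpha R d * opnorm (su_val U - 1%:M)) ^+ (2 ^ size Vs).
Proof.
move=> d2; elim: Vs U => [|V Vs IH] U xs /=; first by rewrite expn0 expr1.
have a1 := alpha_ge1 d.
have [x1 step] := @quadratic_step (alpha R d) (opnorm (su_val U - 1%:M)) a1 (opnorm_ge0 _) xs.
have yx := opnorm_su_g V U.
have zy := su_f_contraction d2 (le_trans yx x1).
have [az az4] := step _ _ (opnorm_ge0 _) yx zy.
apply: le_trans (IH _ az4) _.
have ge0 (M : 'M[C]_d) : 0 <= alpha R d * opnorm M.
  by apply: mulr_ge0 (opnorm_ge0 _); apply: ltW; exact: alpha_gt0.
exact: (exprn_pow2_le _ (ge0 _) az).
Qed.

Lemma adj_unitary d (A : 'M[C]_d) : A \is unitarymx -> A^t* \is unitarymx.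
Proof. by rewrite trmxC_unitary. Qed.

Lemma opnorm_adjB d (A B : 'M[C]_d) : A \is unitarymx -> B \is unitarymx ->
  opnorm (A^t* - B^t*) <= opnorm (A - B).
Proof.
move=> uA uB.
have -> : A^t* - B^t* = A^t* *m (B - A) *m B^t*.
  by rewrite mulmxBr mulmxBl (unitarymxPl uA) mul1mx -mulmxA (unitarymxP uB) mulmx1.
rewrite opnormB.
exact: le_trans (opnorm_unitaryMr _ (adj_unitary uB)) (opnorm_unitaryMl _ (adj_unitary uA)).
Qed.

Lemma opnorm_mulB d (A B A' B' : 'M[C]_d) : A \is unitarymx -> B' \is unitarymx ->
  opnorm (A *m B - A' *m B') <= opnorm (A - A') + opnorm (B - B').
Proof.
move=> uA uB'.
have -> : A *m B - A' *m B' = A *m (B - B') + (A - A') *m B'.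
  by rewrite mulmxBr mulmxBl addrA subrK.
rewrite addrC; apply: le_trans (opnormD _ _) _; apply: lerD.
  exact: opnorm_unitaryMr.
exact: opnorm_unitaryMl.
Qed.

Lemma opnorm_conjB d (V V' U U' : 'M[C]_d) : V \is unitarymx -> V' \is unitarymx ->
  U \is unitarymx -> U' \is unitarymx ->
  opnorm (V *m U *m V^t* - V' *m U' *m V'^t*) <=
  opnorm (U - U') + opnorm (V - V') *+ 2.
Proof.
move=> uV uV' uU uU'; have uV't := adj_unitary uV'.
apply: le_trans (opnorm_mulB _ _ (mul_unitarymx uV uU) uV't) _.
apply: le_trans (lerD (opnorm_mulB _ _ uV uU') (opnorm_adjB uV uV')) _.
by rewrite mulr2n addrAC addrC.
Qed.

Lemma opnorm_prodB d m (A B : 'I_m -> 'M[C]_d) (c : 'I_m -> R) :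
  (forall i, [/\ A i \is unitarymx, B i \is unitarymx & opnorm (A i - B i) <= c i]) ->
  [/\ \prod_i A i \is unitarymx, \prod_i B i \is unitarymx &
      opnorm (\prod_i A i - \prod_i B i) <= \sum_i c i].
Proof.
move=> h; apply: (big_ind3 (fun a b c => [/\ a \is unitarymx, b \is unitarymx &
  opnorm (a - b) <= c])).
- by split; rewrite ?mx1_unitary// subrr opnorm0.
- move=> a b s a' b' s' [ua ub ab] [ua' ub' ab'].
  split; [exact: mul_unitarymx|exact: mul_unitarymx|].
  exact: le_trans (opnorm_mulB _ _ ua ub') (lerD ab ab').
- by move=> i _; exact: h.
Qed.

Lemma weyl_twirlB d (U U' : 'M[C]_d) : U \is unitarymx -> U' \is unitarymx ->
  opnorm (weyl_twirl U - weyl_twirl U') <= (d ^ 2)%:R * opnorm (U - U').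
Proof.
move=> uU uU'.
have [|_ _] := @opnorm_prodB d d
  (fun a1 : 'I_d => \prod_(a2 < d) (weyl R d a1 a2 *m U *m (weyl R d a1 a2)^t*))
  (fun a1 : 'I_d => \prod_(a2 < d) (weyl R d a1 a2 *m U' *m (weyl R d a1 a2)^t*))
  (fun=> \sum_(a2 < d) opnorm (U - U')).
  move=> a1; apply: opnorm_prodB => a2; have uw := weyl_unitary R d a1 a2.
  split; [exact: conj_unitary|exact: conj_unitary|].
  by rewrite -mulmxBl -mulmxBr; exact: opnorm_conj_unitary.
rewrite !sumr_const card_ord -mulrnA mulr_natl; exact.
Qed.

(** A round takes distance x to at most d^2 (x + 2 t). Carrying x + t instead of x makes the
    recursion geometric: d^2 (x + 2 t) + t <= (2 d^2 + 1) (x + t). *)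
Lemma su_F_lipschitz d (Vs Vs' : seq (SU R d)) (U U' : SU R d) (t : R) :
  size Vs = size Vs' ->
  (forall i, opnorm (su_val (nth (su1 R d) Vs i) - su_val (nth (su1 R d) Vs' i)) <= t) ->
  opnorm (su_val (su_F Vs U) - su_val (su_F Vs' U')) <=
  (d ^ 2 * 2 + 1)%:R ^+ size Vs * (opnorm (su_val U - su_val U') + t).
Proof.
elim: Vs Vs' U U' => [|V Vs IH] [|V' Vs'] //= U U'.
  (* Past the end both sequences return the default [su1], so the hypothesis yields 0 <= t. *)
  move=> _ /(_ 0%N)/= h; rewrite expr0 mul1r lerDl; apply: le_trans h.
  exact: opnorm_ge0.
case=> sz h; have hV := h 0%N; rewrite /= in hV.
apply: le_trans (IH _ _ _ sz (fun i => h i.+1)) _.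
rewrite exprSr -mulrA ler_wpM2l ?exprn_ge0//.
set K := (d ^ 2)%N.
have t0 : 0 <= t by apply: le_trans hV; exact: opnorm_ge0.
set x := opnorm (su_val U - su_val U').
have x0 : 0 <= x by exact: opnorm_ge0.
apply: (@le_trans _ _ (K%:R * (x + t *+ 2) + t)).
  rewrite lerD2r; apply: le_trans (weyl_twirlB _ _) _; rewrite ?su_unitary//.
  rewrite ler_wpM2l//; apply: le_trans (opnorm_conjB _ _ _ _) _; rewrite ?su_unitary//.
  by rewrite lerD2l lerMn2r hV orbT.
rewrite natrD natrM mulr2n.
have K0 : 0 <= K%:R :> R by [].
nra.
Qed.

Lemma exists_diagonalizer d (U : SU R d) : (0 < d)%N ->
  exists (V0 : SU R d) (lam : 'rV[C]_d),
    [/\ su_val V0 *m su_val U *m (su_val V0)^t* = diag_mx lam,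
        forall j, normc (lam ord0 j) = 1 & \prod_j lam ord0 j = 1].
Proof.
move=> d0; have [P [l [uP UE nl]]] := unitary_spectral (su_unitary U).
have PP := unitarymxP uP.
have dP : normc (\det P) = 1.
  apply/eqP; rewrite unit_normc; have := congr1 determinant (unitarymxPl uP).
  by rewrite det_mulmx det_map_mx det_tr det1 => ->.
have dP0 : \det P != 0.
  by apply/eqP => dP0; move: dP; rewrite dP0 ComplexField.Normc.normc0 => /eqP; rewrite eq_sym oner_eq0.
(* A unimodular scalar does not change conjugation by P, so it can be used to bring the determinant
   to 1. *)
pose c := d.-root ((\det P)^-1).
have cd : c ^+ d = (\det P)^-1 by rewrite rootCK.
have nc : normc c = 1.
  apply/eqP; rewrite -(pexpr_eq1 d0 (normc_ge0 _)); apply/eqP.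
  have -> : normc c ^+ d = normc (c ^+ d).
    elim: d {P l uP UE nl PP dP dP0 cd U d0} c => [|n IH] c0; first by rewrite !expr0 ComplexField.Normc.normc1.
    by rewrite !exprS ComplexField.Normc.normcM IH.
  by rewrite cd ComplexField.Normc.normcV dP invr1.
have cc : c^*%R * c = 1 by apply/eqP; rewrite -unit_normc nc.
have V0P : ((c *: P) \is unitarymx) && (\det (c *: P) == 1).
  apply/andP; split.
    apply/unitarymxP; rewrite linearZ /= map_mxZ -scalemxAl -scalemxAr PP scalerA mulrC cc.
    by rewrite scale1r.
  by rewrite detZ cd mulVf.
exists (MkSU V0P), l; split => //=.
  rewrite UE linearZ /= map_mxZ -!scalemxAl -scalemxAr scalerA mulrC cc scale1r.
  by rewrite !mulmxA PP mul1mx -mulmxA PP mulmx1.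
rewrite -det_diag -(su_det U) [X in \det X = _](_ : _ = P *m su_val U *m P^t*).
  by rewrite det_conj_unitary.
by rewrite UE !mulmxA PP mul1mx -mulmxA PP mulmx1.
Qed.

(* At a diagonalizer [V0] the Weyl product is exactly 1. Near it the error is
   quadratic: its linear term is [d * \tr E] where [1 + E] lies in SU(d), and
   such a trace is itself of second order. *)
Lemma exists_landing_point d (U : SU R d) : (0 < d)%N ->
  exists V0 : SU R d, forall (V : SU R d) (r : R),
    2 * (d ^ 2)%:R * r <= 9 / 50 ->
    opnorm (su_val V - su_val V0) <= r ->
    opnorm (su_val (su_f (su_g V U)) - 1%:M) <= 11 / 5 * (d ^ 3 + d ^ 4)%:R * r ^+ 2.
Proof.
move=> d0; have [V0 [l [V0E nl pl]]] := exists_diagonalizer U d0.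
exists V0 => V r rs Vr.
have r0 : 0 <= r by exact: le_trans (opnorm_ge0 _) Vr.
apply: le_trans (weyl_twirl_diag_bound nl pl (su_unitary _) (su_det _)) _.
set e := opnorm _.
have e0 : 0 <= e by exact: opnorm_ge0.
have er : e <= 2 * r.
  rewrite /e -V0E; apply: le_trans (opnorm_conjB _ _ _ _) _; rewrite ?su_unitary//.
  by rewrite subrr opnorm0 add0r mulr_natl lerMn2r Vr orbT.
have bnd n : n%:R * (2 * r) <= 9 / 50 -> quad_rem n e <= 11 / 20 * (n%:R * (2 * r)) ^+ 2.
  move=> nr; have ne : n%:R * e <= n%:R * (2 * r) by rewrite ler_wpM2l.
  apply: le_trans (quad_rem_le_sqr e0 (le_trans ne nr)) _.
  rewrite ler_wpM2l ?divr_ge0// ler_pXn2r ?nnegrE ?mulr_ge0//.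
have r2 : (d ^ 2)%:R * (2 * r) <= 9 / 50 by rewrite mulrA [_ * 2]mulrC.
have r1 : d%:R * (2 * r) <= 9 / 50.
  apply: le_trans r2; rewrite ler_wpM2r ?mulr_ge0// ler_nat expnS expn1 leq_pmull//.
(* Here 11/20 * (2 n r)^2 = 11/5 * n^2 r^2; n = d with prefactor d contributes d^3, and n = d^2
   contributes d^4. *)
apply: le_trans (lerD (ler_wpM2l (ler0n _ d) (bnd d r1)) (bnd _ r2)) _.
rewrite natrD !natrX le_eqVlt; by apply/orP; left; apply/eqP; field.
Qed.

End Dynamics.

(** * Pulse sequences and their length *)

Section PulseSequences.
Variable R : realType.
Local Notation C := R[i].

(** The trailing unitary B lets words be concatenated; it is removed only at the end, by a
    conjugation. Indexing the pulses by [nat] avoids casts between ordinals. *)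
Definition pulse_sequence d (T : Type) (u : T -> 'M[C]_d) (n : nat) (M : T -> 'M[C]_d) :=
  exists (Q : nat -> 'M[C]_d) (B : 'M[C]_d),
    [/\ forall j, Q j \is unitarymx, B \is unitarymx &
        forall U, M U = (\prod_(j < n) (Q j *m u U)) *m B].

Section Fixed.
Variables (d : nat) (T : Type) (u : T -> 'M[C]_d).
Local Notation pulse_sequence := (pulse_sequence u).

Lemma mul_prod_pulses (S : 'M[C]_d) (Q : nat -> 'M[C]_d) n U :
  S *m \prod_(j < n.+1) (Q j *m u U) =
  \prod_(j < n.+1) ((if val j is 0%N then S *m Q 0%N else Q j) *m u U).
Proof. by rewrite !big_ord_recl /= ![_ * _](erefl (_ *m _)) !mulmxA. Qed.

Lemma pulse_sequence_const (B : 'M[C]_d) : B \is unitarymx ->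
  pulse_sequence 0 (fun=> B).
Proof.
move=> uB; exists (fun=> 1%:M), B; split=> [_||U]; [exact: mx1_unitary|exact: uB|].
by rewrite big_ord0 mul1mx.
Qed.

Lemma pulse_sequence_id : pulse_sequence 1 u.
Proof.
exists (fun=> 1%:M), 1%:M; split=> [_||U]; rewrite ?mx1_unitary//.
by rewrite big_ord_recl big_ord0 mulmx1 mulr1 mul1mx.
Qed.

Lemma pulse_sequenceM n m M N : pulse_sequence n M -> pulse_sequence m N ->
  pulse_sequence (n + m) (fun U => M U *m N U).
Proof.
move=> [Q [B [uQ uB ME]]] [Q' [B' [uQ' uB' NE]]].
(* If the second word is empty, it has no first pulse to absorb B, which then joins the trailing
   unitary. *)
case: m NE => [|m] NE.
  exists Q, (B *m B'); split=> [||U]; [exact: uQ|exact: (mul_unitarymx uB uB')|].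
  by rewrite addn0 ME NE big_ord0 mul1mx mulmxA.
pose Q2 j := if j is 0%N then B *m Q' 0%N else Q' j.
exists (fun j => if (j < n)%N then Q j else Q2 (j - n)%N), B'.
split=> [j||U]; [|exact: uB'|].
  case: ifP => _; first exact: uQ.
  rewrite /Q2; case: (j - n)%N => [|j']; last exact: uQ'.
  exact: (mul_unitarymx uB (uQ' 0%N)).
rewrite ME NE big_split_ord /= mulmxA -(mulmxA _ B) mul_prod_pulses.
congr (_ *m _ *m _); apply: eq_bigr => j _ /=; first by rewrite ltn_ord.
by rewrite ltnNge leq_addr /= addKn; case: (nat_of_ord j).
Qed.

Lemma pulse_sequence_conj n M (S : 'M[C]_d) : S \is unitarymx ->
  pulse_sequence n M -> pulse_sequence n (fun U => S *m M U *m S^t*).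
Proof.
move=> uS hM; rewrite -[n]addn0 -[n]add0n; apply: pulse_sequenceM; last first.
  by apply: pulse_sequence_const; exact: adj_unitary.
by apply: pulse_sequenceM hM; exact: pulse_sequence_const.
Qed.

Lemma pulse_sequence_prod m n (M : nat -> T -> 'M[C]_d) :
  (forall i, pulse_sequence n (M i)) ->
  pulse_sequence (m * n) (fun U => \prod_(i < m) M i U).
Proof.
move=> hM; elim: m => [|m [Q [B [uQ uB E]]]].
  have [Q [B [uQ uB E]]] := pulse_sequence_const (mx1_unitary R d).
  by exists Q, B; split => // U; rewrite mul0n -E big_ord0.
have := pulse_sequenceM (ex_intro _ Q (ex_intro _ B (And3 uQ uB E))) (hM m).
move=> [Q' [B' [uQ' uB' E']]]; exists Q', B'; split => // U.
by rewrite big_ord_recr /= [LHS]E' mulSn addnC.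
Qed.

Lemma pulse_sequence_twirl n M : pulse_sequence n M ->
  pulse_sequence (d * (d * n)) (fun U => weyl_twirl (M U)).
Proof.
move=> hM; apply: (@pulse_sequence_prod d (d * n) (fun a1 U =>
  \prod_(a2 < d) (weyl R d a1 a2 *m M U *m (weyl R d a1 a2)^t*))) => a1.
apply: (@pulse_sequence_prod d n (fun a2 U =>
  weyl R d a1 a2 *m M U *m (weyl R d a1 a2)^t*)) => a2.
by apply: pulse_sequence_conj hM; exact: weyl_unitary.
Qed.

End Fixed.

(** The input is a general word [M], so that the induction can feed in the output of the first
    round. *)
Lemma pulse_sequence_su_F d (Vs : seq (SU R d)) (T : Type) (u : T -> 'M[C]_d)
    n (M : T -> SU R d) :
  pulse_sequence u n (fun U => su_val (M U)) ->
  pulse_sequence u (d ^ (2 * size Vs) * n) (fun U => su_val (su_F Vs (M U))).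
Proof.
elim: Vs n M => [|V Vs IH] n M hM /=; first by rewrite muln0 mul1n.
rewrite (_ : (_ * n)%N = (d ^ (2 * size Vs) * (d * (d * n)))%N); last first.
  by rewrite mulnS expnD -mulnA mulnCA -mulnn -!mulnA.
apply: (IH _ (fun U => su_f (su_g V (M U)))) => /=.
by apply: pulse_sequence_twirl; apply: pulse_sequence_conj hM; exact: su_unitary.
Qed.

(** The conjugating unitary is the trailing B: conjugation moves it to the front, where it merges
    with the first pulse. Positivity of d ensures that there is one. *)
Lemma su_F_pulses d k (Vs : k.-tuple (SU R d)) : (0 < d)%N ->
  exists (W : 'M[C]_d) (Q : 'I_(d ^ (2 * k)) -> 'M[C]_d),
    [/\ W \is unitarymx, forall j, Q j \is unitarymx &
        forall U : SU R d,
          W *m su_val (su_F Vs U) *m W^t* =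
          \prod_(j < d ^ (2 * k)) (Q j *m su_val U)].
Proof.
move=> d0; have := pulse_sequence_su_F Vs (M := id) (pulse_sequence_id (@su_val R d)).
rewrite size_tuple muln1 => -[Q [B [uQ uB E]]].
exists B, (fun j => if nat_of_ord j is 0%N then B *m Q 0%N else Q j).
split=> [|j|U]; first exact: uB.
  by case: (nat_of_ord j) => [|?]; [exact: (mul_unitarymx uB (uQ 0%N))|exact: uQ].
rewrite E mulmxA -mulmxA (unitarymxP uB) mulmx1.
have := expn_gt0 d (2 * k); rewrite d0 /=.
by case: (d ^ (2 * k))%N => // n _; rewrite mul_prod_pulses.
Qed.

End PulseSequences.

(** * Growth of the number of pulses *)

Section PulseCount.
Variable R : realType.

(** The integer 10 / [delta], so that 1 / [succ_prob] is a natural number and can be compared with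
    cardinals of codes. *)
Definition trial_base d := (10 * 2 ^ (d ^ 2 + 2) * d ^ 2)%N.

Lemma trial_base_gt1 d : (0 < d)%N -> (1 < trial_base d)%N.
Proof.
move=> d0; rewrite /trial_base.
have : (0 < 2 ^ (d ^ 2 + 2))%N by rewrite expn_gt0.
have : (0 < d ^ 2)%N by rewrite expn_gt0 d0.
nia.
Qed.

Lemma succ_probE d : (0 < d)%N ->
  succ_prob R d = (trial_base d ^ (d ^ 2 - 1))%:R^-1.
Proof.
move=> d0; rewrite /succ_prob natrX -exprVn; congr (_ ^+ _).
rewrite /delta /trial_base /alpha !natrM !natrX !exprD.
by field; rewrite pnatr_eq0 -lt0n d0 expf_neq0.
Qed.

Lemma succ_prob_gt0 d : (0 < d)%N -> 0 < succ_prob R d.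
Proof.
move=> d0; rewrite succ_probE// invr_gt0 ltr0n expn_gt0.
by rewrite (ltn_trans _ (trial_base_gt1 d0)).
Qed.

Lemma succ_prob_lt1 d : (2 <= d)%N -> succ_prob R d < 1.
Proof.
move=> d2; have d0 : (0 < d)%N by exact: ltnW.
rewrite succ_probE// invf_lt1 ?ltr0n ?expn_gt0 ?(ltn_trans _ (trial_base_gt1 d0))//.
rewrite ltr1n -[X in (X < _)%N](expn0 (trial_base d)) ltn_exp2l ?trial_base_gt1//.
by rewrite subn_gt0; apply: leq_trans (_ : 2 <= d ^ 2)%N => //; nia.
Qed.

(** With n = d^2, [trial_base d] is at most 2^(n + 2 d + 6), and raising it to the power n - 1 gives
    an exponent of order n^2 = d^4. *)
Lemma pulse_exponent_le d : (2 <= d)%N ->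
  (2 * d * trial_base d ^ (d ^ 2 - 1) <= 2 ^ (20 * d ^ 4))%N.
Proof.
move=> d2; set n := (d ^ 2)%N.
have dn : (d <= 2 ^ d)%N by apply: ltnW; exact: ltn_expl.
have n4 : (4 <= n)%N by rewrite /n; nia.
have dn' : (d <= n)%N by rewrite /n; nia.
have tb : (trial_base d <= 2 ^ (n + 2 * d + 6))%N.
  rewrite /trial_base -/n.
  have -> : (2 ^ (n + 2 * d + 6) = 16 * 2 ^ (n + 2) * (2 ^ d) ^ 2)%N.
    by rewrite -expnM -[16%N]/(2 ^ 4)%N -!expnD; congr expn; lia.
  apply: leq_mul; first by rewrite leq_mul2r orbC.
  by rewrite /n leq_exp2r.
apply: (@leq_trans (2 ^ (1 + d) * 2 ^ ((n + 2 * d + 6) * (n - 1)))).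
  apply: leq_mul; first by rewrite expnD leq_mul2l.
  by rewrite expnM; case: (n - 1)%N => // m; rewrite leq_exp2r.
rewrite -expnD leq_exp2l//.
have -> : (d ^ 4 = n * n)%N by rewrite /n -expnD.
nia.
Qed.

(** The left-hand side is the exponent of 1 / eta in d^(2 [trials]). It is at most 2 d / p, by - ln
    (1 - p) >= p and ln d <= d. *)
Lemma ln_inv_le_succ_prob d : (2 <= d)%N ->
  2 * ln d%:R / - ln (1 - succ_prob R d) <= 2 ^+ (20 * d ^ 4).
Proof.
move=> d2; have d0 : (0 < d)%N by exact: ltnW.
have p0 := succ_prob_gt0 d0; have p1 := succ_prob_lt1 d2.
set p := succ_prob R d in p0 p1 *.
have lnp : p <= - ln (1 - p).
  rewrite lerNr; apply: (@le_ln1Dx R (- p)); lra.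
rewrite ler_pdivrMr ?(lt_le_trans p0)//.
apply: (@le_trans _ _ (2 ^+ (20 * d ^ 4) * p)); last by rewrite ler_wpM2l ?exprn_ge0.
rewrite /p succ_probE// ler_pdivlMr ?ltr0n ?expn_gt0 ?(ltn_trans _ (trial_base_gt1 d0))//.
apply: (@le_trans _ _ (2 * d%:R * (trial_base d ^ (d ^ 2 - 1))%:R)).
  rewrite ler_wpM2r// ler_wpM2l//; apply: ltW; apply: ln_sublinear.
  by rewrite ltr0n.
by rewrite -!natrM -natrX ler_nat pulse_exponent_le.
Qed.

Lemma pulse_count_le d (eps eta : R) (k : nat) :
  (2 <= d)%N -> 0 < eps -> eps < 1 / alpha R d -> 0 < eta -> eta < 1 ->
  k%:Z = Num.ceil (trials d eta + doublings d eps) ->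
  (d ^ (2 * k))%:R <=
    d%:R ^+ 2 * (1 / eta) `^ (2 `^ (20 * d%:R ^+ 4))
    * (log2 (1 / eps) - d%:R ^+ 2 - 1) `^ (2 * log2 d%:R) :> R.
Proof.
move=> d2 e0 ea h0 h1 kE; have d0 : (0 < d)%N by exact: ltnW.
have a0 := alpha_gt0 R d.
have ln2 : 0 < ln 2 :> R by rewrite ln_gt0// ltr1n.
have dp : 0 < d%:R :> R by rewrite ltr0n.
set L := log2 (1 / (alpha R d * eps)).
(* The subtracted d^2 + 1 is log2 of [alpha]. *)
have LE : log2 (1 / eps) - d%:R ^+ 2 - 1 = L.
  have aE : ln (alpha R d)^-1 / ln 2 = - (d%:R ^+ 2 + 1).
    rewrite lnV ?posrE// /alpha lnXn// mulNr -[ln 2 *+ _]mulr_natl mulfK ?gt_eqF//.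
    by rewrite natrD natrX.
  by rewrite /L /log2 !div1r invfM lnM ?posrE ?invr_gt0// mulrDl aE; ring.
have L0 : 0 < L.
  rewrite /L /log2 divr_gt0// ln_gt0// div1r invf_gt1 ?mulr_gt0//.
  by move: ea; rewrite ltr_pdivlMr// mulrC.
rewrite {}LE.
(* Rounding up costs at most one round, which accounts for the factor d^2 of the bound. *)
have kle : k%:R <= trials d eta + doublings d eps + 1.
  have := ceilB1_lt (trials d eta + doublings d eps); rewrite -kE intrB.
  by rewrite ltrBlDr => /ltW.
have ieta : 0 < 1 / eta by rewrite div1r invr_gt0.
pose l : R := ln d%:R.
have l0 : 0 <= l by rewrite ln_ge0// ler1n ltnW.
have dE n : d%:R ^+ n = expR (n%:R * l) by rewrite expRM_natl lnK ?posrE.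
have -> : 2 `^ (20 * d%:R ^+ 4) = 2 ^+ (20 * d ^ 4) :> R.
  by rewrite -natrX -natrM powR_mulrn.
rewrite /powR !gt_eqF// natrX !dE -!expRD ler_expR.
(* The identity L^(2 log2 d) = d^(2 log2 L), written in exponents. *)
have -> : 2 * log2 d%:R * ln L = doublings d eps * (2 * l).
  by rewrite /doublings -/L /log2 -/l; field; rewrite gt_eqF.
have Tle : trials d eta * (2 * l) <= 2 ^+ (20 * d ^ 4) * ln (1 / eta).
  have p0 := succ_prob_gt0 d0; have p1 := succ_prob_lt1 d2.
  have lp : ln (1 - succ_prob R d) < 0 by apply: ln_lt0; lra.
  have -> : trials d eta * (2 * l) =
      2 * l / - ln (1 - succ_prob R d) * ln (1 / eta).
    rewrite /trials /log2 div1r lnV ?posrE//; field.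
    by rewrite (lt_eqF lp) gt_eqF.
  apply: ler_wpM2r; last exact: ln_inv_le_succ_prob.
  by rewrite ln_ge0// div1r invf_ge1// ltW.
apply: (@le_trans _ _ ((trials d eta + doublings d eps + 1) * (2 * l))).
  by rewrite natrM -mulrA mulrCA ler_wpM2r// mulr_ge0.
rewrite !mulrDl mul1r; lra.
Qed.

Lemma bigO_pow4 (c : R) : 0 <= c ->
  (fun d : nat => c * d%:R ^+ 4 : R) =O_\oo (fun d : nat => d%:R ^+ 4 : R).
Proof.
move=> c0; apply/eqO_exP; exists (c + 1); first by rewrite ltr_wpDl.
apply: nearW => n; rewrite normrM (ger0_norm c0).
by rewrite ler_wpM2r// lerDl.
Qed.

End PulseCount.

(** * Coverings of SU(d) *)

Section Covering.
Variable R : realType.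
Local Notation C := R[i].
Local Notation normc := (@ComplexField.Normc.normc R).

(** Cuts [-1, 1] into m + 1 equal intervals; the minimum puts the endpoint 1 into the last one. *)
Definition cell m (x : R) : 'I_m.+1 :=
  inord (minn m (Num.truncn ((x + 1) * (m.+1%:R / 2)))).

Lemma cell_dist m (x y : R) : `|x| <= 1 -> `|y| <= 1 -> cell m x = cell m y ->
  `|x - y| <= 2 / m.+1%:R.
Proof.
rewrite !ler_norml => /andP[x0 x1] /andP[y0 y1] /(congr1 (@nat_of_ord m.+1)).
rewrite !inordK ?ltnS ?geq_minl//.
set M : R := m.+1%:R / 2; have M0 : 0 < M by rewrite divr_gt0.
have bnd z : -1 <= z -> z <= 1 -> 0 <= (z + 1) * M <= m%:R + 1.
  move=> z0 z1; rewrite mulr_ge0 ?(ltW M0)//=; last by lra.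
  have -> : m%:R + 1 = 2 * M :> R by rewrite /M natr1; field.
  by rewrite ler_wpM2r ?(ltW M0)//; lra.
have /andP[a0 am] := bnd x x0 x1; have /andP[b0 bm] := bnd y y0 y1.
set a := (x + 1) * M in a0 am *; set b := (y + 1) * M in b0 bm *.
have /andP[la ua] := truncn_itv a0; have /andP[lb ub] := truncn_itv b0.
have -> : 2 / m.+1%:R = M^-1 :> R by rewrite /M invf_div.
have key : -1 <= a - b <= 1 -> - M^-1 <= x - y <= M^-1.
  have -> : a - b = (x - y) * M by rewrite /a /b; ring.
  move=> ab; rewrite -ler_norml -(ler_pM2r M0) mulVf ?gt_eqF//.
  by rewrite -{1}(gtr0_norm M0) -normrM ler_norml.
move=> e; apply: key.
case: (leqP m (Num.truncn a)) e => [ma|am'];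
    case: (leqP m (Num.truncn b)) => [mb|bm'] e.
- have : m%:R <= a by apply: le_trans la; rewrite ler_nat.
  have : m%:R <= b by apply: le_trans lb; rewrite ler_nat.
  lra.
- by move: bm'; rewrite -e ltnn.
- by move: am'; rewrite e ltnn.
- by move: ua la; rewrite e -natr1; move: ub; rewrite -natr1; lra.
Qed.

Lemma normc_Re (x : C) : `|complex.Re x| <= normc x.
Proof.
by case: x => a b /=; rewrite -sqrtr_sqr ler_sqrt ?addr_ge0 ?sqr_ge0// lerDl sqr_ge0.
Qed.

Lemma normc_Im (x : C) : `|complex.Im x| <= normc x.
Proof.
by case: x => a b /=; rewrite -sqrtr_sqr ler_sqrt ?addr_ge0 ?sqr_ge0// lerDr sqr_ge0.
Qed.

Lemma sqr_normcRI (x : C) : normc x ^+ 2 = complex.Re x ^+ 2 + complex.Im x ^+ 2.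
Proof. by case: x => a b /=; rewrite sqr_sqrtr// addr_ge0 ?sqr_ge0. Qed.

Lemma normc_le_ReIm (x : C) (c : R) : 0 <= c ->
  `|complex.Re x| <= c -> `|complex.Im x| <= c -> normc x ^+ 2 <= 2 * c ^+ 2.
Proof.
move=> c0; rewrite sqr_normcRI !ler_norml => /andP[? ?] /andP[? ?]; nra.
Qed.

Lemma unit_sqrt (x : C) : normc x = 1 ->
  exists w : C, [/\ w * w = x, normc w = 1 & 0 <= complex.Re w].
Proof.
move=> x1; pose w := sqrtC x.
have ww : w * w = x by rewrite -expr2 sqrtCK.
have nw : normc w = 1.
  apply/eqP; rewrite -(@eqrXn2 _ 2) ?normc_ge0// expr1n expr2.
  by rewrite -ComplexField.Normc.normcM ww x1.
case: (lerP 0 (complex.Re w)) => w0; first by exists w.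
exists (- w); split; first by rewrite mulrNN.
  by rewrite normcN.
by move: w0; case: w {ww nw} => a b /=; lra.
Qed.

(* Cayley transform of a square root: for [|x| = 1] with square root [w] in the
   right half plane, [c = (w + 1) / 2 = 1 / (1 - i t)] where [t] is the tangent
   of half the argument of [w], so [|t| <= 1]. *)
Lemma unit_cayley (x : C) : normc x = 1 ->
  exists (t : R) (c : C), [/\ `|t| <= 1, (1 - 'i * t%:C) * c = 1,
    (c *+ 2 - 1) * (c *+ 2 - 1) = x, normc c <= 1 & normc (c *+ 2 - 1) = 1].
Proof.
move=> /unit_sqrt[[a b] [ww nw a0]]; rewrite /= in a0.
have ab : a ^+ 2 + b ^+ 2 = 1 by rewrite -(sqr_normcRI (a +i* b)) nw expr1n.
have a1 : 1 + a != 0 by apply/eqP; lra.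
have half : ((2^-1)%:C : C) *+ 2 = 1.
  by apply/eqP; rewrite mulr2n eq_complex /=; apply/andP; split; apply/eqP; field.
exists (b / (1 + a)), ((1 + a +i* b) * (2^-1)%:C).
have cE : ((1 + a +i* b) * (2^-1)%:C) *+ 2 - 1 = a +i* b.
  rewrite -mulrnAr half mulr1.
  by apply/eqP; rewrite eq_complex /=; apply/andP; split; apply/eqP; ring.
split; rewrite ?cE//.
- have ap : 0 < 1 + a by lra.
  by rewrite ler_norml ler_pdivlMr// ler_pdivrMr//; apply/andP; split; nra.
- apply/eqP; rewrite eq_complex /=; apply/andP; split; apply/eqP; last by field.
  have bb : b * b = 1 - a * a by move: ab; rewrite !expr2; lra.
  apply: (mulfI a1); transitivity ((1 + a) * (1 + a) / 2 + b * b / 2); first by field.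
  by rewrite bb; field.
- rewrite -(@ler_pXn2r _ 2) ?nnegrE ?normc_ge0// expr1n sqr_normcRI /=.
  have : a <= 1 by have := sqr_ge0 b; nra.
  by nra.
Qed.

(** D is the inverse of 1 - i A, and 2 D - 1 is a square root of V. Passing to a square root with
    spectrum in the right half plane keeps A bounded; the Cayley transform of V itself is singular
    at the eigenvalue -1. *)
Definition cayley_pair d (V A D : 'M[C]_d) :=
  [/\ A^t* = A, forall i j, normc (A i j) <= 1,
      (1%:M - 'i%C *: A) *m D = 1%:M /\ D *m (1%:M - 'i%C *: A) = 1%:M,
      (D *+ 2 - 1%:M) *m (D *+ 2 - 1%:M) = V &
      opnorm D <= 1 /\ D *+ 2 - 1%:M \is unitarymx].

Section FunctionalCalculus.
Variables (d : nat) (P : 'M[C]_d).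
Hypothesis uP : P \is unitarymx.
Implicit Types u v : 'I_d -> C.

Definition spectral_fun v : 'M[C]_d := P^t* *m diag_mx (\row_j v j) *m P.

Lemma spectral_funM u v :
  spectral_fun u *m spectral_fun v = spectral_fun (fun j => u j * v j).
Proof.
have uvE : diag_mx (\row_j u j) *m diag_mx (\row_j v j) = diag_mx (\row_j (u j * v j)).
  by rewrite mulmx_diag; congr diag_mx; apply/rowP => j; rewrite !mxE.
rewrite /spectral_fun -uvE -!mulmxA (mulmxA P) (unitarymxP uP) mul1mx.
by [].
Qed.

Lemma spectral_fun1 : spectral_fun (fun=> 1) = 1%:M.
Proof.
rewrite /spectral_fun [X in diag_mx X](_ : _ = const_mx 1).
  by rewrite diag_const_mx mulmx1 (unitarymxPl uP).
by apply/rowP => j; rewrite !mxE.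
Qed.

Lemma spectral_funB u v :
  spectral_fun u - spectral_fun v = spectral_fun (fun j => u j - v j).
Proof.
have uvE : diag_mx (\row_j u j) - diag_mx (\row_j v j) = diag_mx (\row_j (u j - v j)).
  by apply/matrixP => i j; rewrite !mxE mulrnBl.
by rewrite /spectral_fun -mulmxBl -mulmxBr uvE.
Qed.

Lemma spectral_funZ (a : C) v : a *: spectral_fun v = spectral_fun (fun j => a * v j).
Proof.
have avE : a *: diag_mx (\row_j v j) = diag_mx (\row_j (a * v j)).
  by apply/matrixP => i j; rewrite !mxE mulrnAr.
by rewrite /spectral_fun scalemxAl scalemxAr avE.
Qed.

Lemma opnorm_spectral_fun v (x : R) : 0 <= x -> (forall j, normc (v j) <= x) ->
  opnorm (spectral_fun v) <= x.
Proof.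
move=> x0 vx; apply: le_trans (opnorm_unitaryMr _ uP) _.
apply: le_trans (opnorm_unitaryMl _ (adj_unitary uP)) _.
by apply: opnorm_diag => // j; rewrite mxE.
Qed.

Lemma spectral_fun_adj v : (spectral_fun v)^t* = spectral_fun (fun j => (v j)^*%R).
Proof.
have vE : (diag_mx (\row_j v j))^t* = diag_mx (\row_j (v j)^*%R).
  by rewrite tr_diag_mx map_diag_mx; congr diag_mx; apply/rowP => j; rewrite !mxE.
by rewrite /spectral_fun !adj_mulmx trmxCK mulmxA vE.
Qed.

Lemma spectral_fun_unitary v : (forall j, normc (v j) = 1) ->
  spectral_fun v \is unitarymx.
Proof.
move=> nv; apply/unitarymxP; rewrite spectral_fun_adj spectral_funM -spectral_fun1.
congr spectral_fun; apply/funext => j; rewrite mulrC.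
by apply/eqP; rewrite -unit_normc nv.
Qed.

End FunctionalCalculus.

Lemma exists_cayley_pair d (V : 'M[C]_d) : V \is unitarymx ->
  exists A D, cayley_pair V A D.
Proof.
move=> /unitary_spectral[P [l [uP -> nl]]].
have /choice[t /choice[c h]] := fun j => unit_cayley (nl j).
pose phi := spectral_fun P.
have DE : phi c *+ 2 - 1%:M = phi (fun j => c j *+ 2 - 1).
  rewrite /phi -scaler_nat spectral_funZ -(spectral_fun1 uP) spectral_funB.
  by congr (spectral_fun P); apply/funext => j; rewrite mulr_natl.
have AE : 1%:M - 'i%C *: phi (fun j => (t j)%:C) = phi (fun j => 1 - 'i%C * (t j)%:C).
  by rewrite /phi spectral_funZ -(spectral_fun1 uP) spectral_funB.
exists (phi (fun j => (t j)%:C)), (phi c); split.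
- rewrite spectral_fun_adj; congr (spectral_fun P); apply/funext => j; apply/eqP.
  by rewrite eq_complex /= oppr0 !eqxx.
- move=> i j; apply: le_trans (opnorm_entry _ _ _) _.
  apply: (opnorm_spectral_fun uP) => [//|k].
  by rewrite /= expr0n /= addr0 sqrtr_sqr; have [] := h k.
- split; rewrite AE (spectral_funM uP) -(spectral_fun1 uP); congr (spectral_fun P);
    apply/funext => j; have [_ hj _ _ _] := h j; first exact: hj.
  by rewrite mulrC.
- have -> : l = \row_j ((c j *+ 2 - 1) * (c j *+ 2 - 1)).
    by apply/rowP => j; rewrite mxE; have [] := h j.
  by rewrite DE (spectral_funM uP).
- split; first by apply: (opnorm_spectral_fun uP) => [//|j]; have [] := h j.
  by rewrite DE; apply: (spectral_fun_unitary uP) => j; have [] := h j.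
Qed.

Lemma ler_mul1 (a b c : R) : 0 <= a -> 0 <= b -> b <= 1 -> a <= c -> a * b <= c.
Proof. by nra. Qed.

(** The resolvent identity D - D' = D i(A - A') D' with contractions D and D' gives constant 1; one
    factor 2 comes from 2 D - 1 and another from squaring. *)
Lemma cayley_lipschitz d (V A D V' A' D' : 'M[C]_d) :
  cayley_pair V A D -> cayley_pair V' A' D' ->
  opnorm (V - V') <= 4 * opnorm (A - A').
Proof.
move=> [_ _ [_ DA] <- [nD uW]] [_ _ [AD' _] <- [nD' uW']].
have WB : opnorm ((D *+ 2 - 1%:M) - (D' *+ 2 - 1%:M)) <= 2 * opnorm (A - A').
  have -> : (D *+ 2 - 1%:M) - (D' *+ 2 - 1%:M) = (D - D') + (D - D').
    by rewrite opprB addrA subrK -mulrnBl mulr2n.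
  suff h : opnorm (D - D') <= opnorm (A - A').
    by apply: le_trans (opnormD _ _) _; rewrite mulr_natl mulr2n lerD.
  have -> : D - D' = D *m ('i%C *: (A - A')) *m D'.
    have -> : 'i%C *: (A - A') = (1%:M - 'i%C *: A') - (1%:M - 'i%C *: A).
      by rewrite scalerBr opprB [RHS]addrC addrA subrK.
    by rewrite mulmxBr mulmxBl DA mul1mx -mulmxA AD' mulmx1.
  apply: le_trans (opnormM _ _) _; apply: ler_mul1 (opnorm_ge0 _) (opnorm_ge0 _) nD' _.
  apply: le_trans (opnormM _ _) _; rewrite mulrC.
  apply: ler_mul1 (opnorm_ge0 _) (opnorm_ge0 _) nD _.
  apply: le_trans (opnorm_scale _ _) _.
  by rewrite /= expr0n expr1n add0r sqrtr1 mul1r.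
apply: le_trans (opnorm_mulB _ _ uW uW') _.
by apply: le_trans (lerD WB WB) _; rewrite -mulrDl -natrD.
Qed.

Lemma cayley_code d m (r : R) : 12 * d%:R / m.+1%:R < r ->
  exists code : SU R d -> {ffun 'I_d * 'I_d -> 'I_m.+1},
    forall V V', code V = code V' -> opnorm (su_val V - su_val V') < r.
Proof.
move=> mr.
have /choice[A /choice[D h]] := fun V : SU R d => exists_cayley_pair (su_unitary V).
(* A Hermitian matrix is encoded by d^2 reals: real parts on and above the diagonal, imaginary parts
   below it. *)
pose x (V : SU R d) (ij : 'I_d * 'I_d) : R :=
  if (ij.1 <= ij.2)%N then complex.Re (A V ij.1 ij.2) else complex.Im (A V ij.1 ij.2).
exists (fun V => [ffun ij => cell m (x V ij)]) => V V' e.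
apply: le_lt_trans mr; apply: le_trans (cayley_lipschitz (h V) (h V')) _.
have [hA nA _ _ _] := h V; have [hA' nA' _ _ _] := h V'.
have x1 W ij : (forall i j, normc (A W i j) <= 1) -> `|x W ij| <= 1.
  move=> nW; rewrite /x; case: ifP => _.
    exact: le_trans (normc_Re _) (nW _ _).
  exact: le_trans (normc_Im _) (nW _ _).
have xd ij : `|x V ij - x V' ij| <= 2 / m.+1%:R.
  apply: cell_dist; [exact: x1|exact: x1|].
  by have := congr1 (fun f : {ffun _ -> _} => f ij) e; rewrite !ffunE.
have herm (B : 'M[C]_d) i j : B^t* = B -> B i j = (B j i)^*%R.
  by move=> /matrixP/(_ i j); rewrite !mxE.
have m0 : 0 <= 2 / m.+1%:R :> R by rewrite divr_ge0.
have ReE (B : 'M[C]_d) i j : B^t* = B -> complex.Re (B i j) = complex.Re (B j i).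
  by move=> /herm ->; case: (B j i).
have ImE (B : 'M[C]_d) i j : B^t* = B -> complex.Im (B i j) = - complex.Im (B j i).
  by move=> /herm ->; case: (B j i).
have ReB (a b : C) : complex.Re (a - b) = complex.Re a - complex.Re b by case: a b => ? ? [].
have ImB (a b : C) : complex.Im (a - b) = complex.Im a - complex.Im b by case: a b => ? ? [].
have dRe i j : `|complex.Re ((A V - A V') i j)| <= 2 / m.+1%:R.
  rewrite !mxE ReB; case: (leqP i j) => ij.
    by have := xd (i, j); rewrite /x /= ij.
  by have := xd (j, i); rewrite /x /= (ltnW ij) !(ReE _ i j).
have dIm i j : `|complex.Im ((A V - A V') i j)| <= 2 / m.+1%:R.
  rewrite !mxE ImB; case: (ltngtP i j) => ij.
  - rewrite !(ImE _ i j)// -opprB normrN opprK addrC.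
    by have := xd (j, i); rewrite /x /= leqNgt ij.
  - by have := xd (i, j); rewrite /x /= leqNgt ij.
  - move/val_inj: ij => <-.
    have := ImE _ i i hA; have := ImE _ i i hA'.
    move: (complex.Im _) (complex.Im _) => p q.
    by move=> ? ?; rewrite (_ : p - q = 0) ?normr0//; lra.
(* Each entry moves by at most sqrt 8 < 3 cell half-units 1 / (m + 1), and d * d entries give the
   factor d. The 12 of the statement is this 3 times the Lipschitz constant 4. *)
have : opnorm (A V - A V') <= 3 * d%:R / m.+1%:R.
  apply: le_trans (opnorm_le_frobenius _) _.
  rewrite -[leRHS]ger0_norm ?mulr_ge0 ?invr_ge0// -sqrtr_sqr ler_sqrt ?sqr_ge0//.
  apply: (@le_trans _ _ (\sum_(i < d) \sum_(j < d) (3 / m.+1%:R) ^+ 2)).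
    apply: ler_sum => i _; apply: ler_sum => j _.
    apply: le_trans (normc_le_ReIm m0 (dRe i j) (dIm i j)) _.
    by rewrite !exprMn mulrA ler_wpM2r ?sqr_ge0//; lra.
  rewrite !sumr_const card_ord -[_ *+ d *+ d]mulrnA -[_ *+ (d * d)]mulr_natr natrM le_eqVlt; apply/orP; left.
  by apply/eqP; field.
have -> : 12 * d%:R / m.+1%:R = 4 * (3 * d%:R / m.+1%:R) :> R by field.
by rewrite ler_pM2l.
Qed.

(** The inverse of V is both its conjugate transpose and, the determinant being 1, its adjugate. *)
Lemma su2_entries (V : SU R 2) :
  su_val V 1 1 = (su_val V 0 0)^*%R /\ su_val V 0 1 = - (su_val V 1 0)^*%R.
Proof.
have uV := su_unitary V.
have adjE : (su_val V)^t* = \adj (su_val V).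
  have VA : su_val V *m \adj (su_val V) = 1%:M by rewrite mul_mx_adj su_det.
  by rewrite -[LHS]mulmx1 -VA mulmxA (unitarymxPl uV) mul1mx.
have cof i j : (\adj (su_val V)) i j = (-1) ^+ (j + i) * su_val V (lift j 0) (lift i 0).
  by rewrite !mxE /cofactor det_mx11 !mxE.
have E i j := congr1 (fun M : 'M[C]_2 => M i j) adjE.
have l00 : lift 0 0 = 1 :> 'I_2 by apply/val_inj.
have l10 : lift 1 0 = 0 :> 'I_2 by apply/val_inj.
split.
  by have := E 0 0; rewrite cof !mxE l00 expr0 mul1r.
by have := E 0 1; rewrite cof !mxE l00 l10 expr1 mulN1r => ->; rewrite opprK.
Qed.

(** Such an M is a quaternion, a real multiple of a unitary, so its norm is that of its first
    column. The shape is preserved by differences, so it applies to V - V'. *)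
Lemma opnorm_quaternion (M : 'M[C]_2) (x : R) : 0 <= x ->
  M 1 1 = (M 0 0)^*%R -> M 0 1 = - (M 1 0)^*%R ->
  normc (M 0 0) ^+ 2 + normc (M 1 0) ^+ 2 <= x ^+ 2 -> opnorm M <= x.
Proof.
move=> x0 M11 M01 hx; apply: opnorm_le => // v.
rewrite -(@ler_pXn2r _ 2) ?nnegrE ?mulr_ge0 ?l2norm_ge0// exprMn.
apply: le_trans (ler_wpM2r (sqr_ge0 _) hx).
have v1 : lift ord0 ord0 = 1 :> 'I_2 by apply/val_inj.
rewrite !sqr_l2norm !big_ord_recl !big_ord0 !mxE !big_ord_recl !big_ord0 !v1.
rewrite -[ord0]/(0 : 'I_2) -[ord0]/(0 : 'I_1) M11 M01.
move: (M 0 0) (M 1 0) (v 0 0) (v 1 0) => [a a'] [b b'] [e e'] [f f'].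
rewrite !sqr_normcRI /= le_eqVlt; apply/orP; left; apply/eqP; ring.
Qed.

Lemma qubit_code m (r : R) : 4 / m.+1%:R < r ->
  exists code : SU R 2 -> {ffun 'I_2 * 'I_2 -> 'I_m.+1},
    forall V V', code V = code V' -> opnorm (su_val V - su_val V') < r.
Proof.
move=> mr.
pose x (V : SU R 2) (ij : 'I_2 * 'I_2) : R :=
  if ij.2 == 0 then complex.Re (su_val V ij.1 0) else complex.Im (su_val V ij.1 0).
exists (fun V => [ffun ij => cell m (x V ij)]) => V V' e.
apply: le_lt_trans mr.
have x1 W ij : `|x W ij| <= 1.
  have nW i j : normc (su_val W i j) <= 1.
    exact: le_trans (opnorm_entry _ _ _) (opnorm_unitary (su_unitary W)).
  rewrite /x; case: ifP => _.
    exact: le_trans (normc_Re _) (nW _ _).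
  exact: le_trans (normc_Im _) (nW _ _).
have xd ij : `|x V ij - x V' ij| <= 2 / m.+1%:R.
  apply: cell_dist; [exact: x1|exact: x1|].
  by have := congr1 (fun f : {ffun _ -> _} => f ij) e; rewrite !ffunE.
have m0 : 0 <= 2 / m.+1%:R :> R by rewrite divr_ge0.
have ReB (a b : C) : complex.Re (a - b) = complex.Re a - complex.Re b by case: a b => ? ? [].
have ImB (a b : C) : complex.Im (a - b) = complex.Im a - complex.Im b by case: a b => ? ? [].
have nd i : normc ((su_val V - su_val V') i 0) ^+ 2 <= 2 * (2 / m.+1%:R) ^+ 2.
  apply: normc_le_ReIm => //; rewrite !mxE ?ReB ?ImB.
    exact: (xd (i, 0)).
  exact: (xd (i, 1)).
have [e1 e2] := su2_entries V; have [f1 f2] := su2_entries V'.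
apply: opnorm_quaternion; first by rewrite divr_ge0.
- by rewrite !mxE e1 f1 rmorphB.
- by rewrite !mxE e2 f2 rmorphB opprB opprK addrC.
apply: le_trans (lerD (nd 0) (nd 1)) _.
by rewrite le_eqVlt; apply/orP; left; apply/eqP; field.
Qed.

End Covering.

(** * Cardinality and radius of the coverings *)

Section LandingNet.

Lemma sqr_le_exp2 d : (4 <= d)%N -> (d ^ 2 <= 2 ^ d)%N.
Proof.
elim: d => // d IH; rewrite leq_eqVlt => /predU1P[<-//|]; rewrite ltnS => d4.
have := IH d4; rewrite [(2 ^ d.+1)%N]expnS -!mulnn; move: (2 ^ d)%N => p; nia.
Qed.

(** The left base is raised to one more power, but it only grows like 2^(d^2 / 2), against 2^(d^2)
    on the right. *)
Lemma net_size_le4 d : (4 <= d)%N ->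
  ((21 * d ^ 3 * 2 ^ ((d ^ 2 + 4)./2)) ^ (d ^ 2) <= trial_base d ^ (d ^ 2 - 1))%N.
Proof.
rewrite /trial_base => d4; set e := _./2; set n := (d ^ 2)%N.
have e2 : (2 * e <= n + 4)%N by rewrite /e /n mul2n -[leqRHS]odd_double_half leq_addl.
have nE : (n = d * d)%N by rewrite /n mulnn.
have n16 : (16 <= n)%N by rewrite nE; nia.
have n2 : (n <= 2 ^ d)%N by exact: sqr_le_exp2.
have d3 : ((d ^ 3) ^ 2 = n ^ 3)%N by rewrite /n -!expnM.
move: n e2 nE n16 n2 d3 => n e2 nE n16 n2 d3.
have [k nk] : exists k, n = k.+1 by exists n.-1; rewrite prednK//; exact: leq_trans n16.
have -> : (n - 1 = k)%N by rewrite nk subn1.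
have k0 : (0 < k)%N by lia.
(* Squaring removes the halved exponent, as 2 e <= n + 4, and turns d^3 into n^3 under the
   square. *)
rewrite -leq_sqr.
have lhs : (((21 * d ^ 3 * 2 ^ e) ^ n) ^ 2 <= 2 ^ ((n + 14) * n + d * (n + 2)) * n ^ (2 * k))%N.
  have sqE : ((21 * d ^ 3 * 2 ^ e) ^ 2 = 21 ^ 2 * n ^ 3 * 2 ^ (2 * e))%N.
    by rewrite expnMn expnMn d3 -[((2 ^ e) ^ 2)%N]expnM [(e * 2)%N]mulnC.
  rewrite -expnM [(n * 2)%N]mulnC expnM sqE.
  apply: (@leq_trans ((2 ^ 10 * n ^ 3 * 2 ^ (n + 4)) ^ n)).
    have le441 : (21 ^ 2 <= 2 ^ 10)%N by [].
    rewrite leq_exp2r ?(leq_trans _ n16)//; apply: leq_mul.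
      by rewrite leq_mul2r le441 orbT.
    by rewrite leq_exp2l.
  have -> : (2 ^ 10 * n ^ 3 * 2 ^ (n + 4) = 2 ^ (n + 14) * n ^ 3)%N.
    by rewrite mulnAC -expnD; congr (2 ^ _ * _)%N; lia.
  rewrite expnMn -!expnM [in leqRHS]expnD -mulnA leq_mul2l; apply/orP; right.
  (* The right-hand side also contains n^(2 k); the n + 2 surplus factors n are bounded by n <=
     2^d. *)
  have -> : (3 * n = (n + 2) + 2 * k)%N by rewrite nk; lia.
  by rewrite expnD leq_mul2r [(2 ^ (d * _))%N]expnM leq_exp2r ?n2 ?orbT// addn2.
apply: leq_trans lhs _.
apply: (@leq_trans (2 ^ ((n + 5) * (2 * k)) * n ^ (2 * k))); last first.
  rewrite -[leqRHS]expnM [(k * 2)%N]mulnC expnM -expnMn leq_exp2r ?muln_gt0 ?k0//.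
  rewrite leq_mul2r; apply/orP; right.
  have -> : (n + 5 = 3 + (n + 2))%N by lia.
  by rewrite expnD leq_mul2r orbC.
rewrite leq_mul2r leq_exp2l//; apply/orP; right.
have -> : (2 * k = 2 * n - 2)%N by lia.
have : (6 * n + d * n + 2 * d + 10 <= n * n)%N by nia.
nia.
Qed.

Lemma net_size_le d : (3 <= d)%N ->
  ((21 * d ^ 3 * 2 ^ ((d ^ 2 + 4)./2)) ^ (d ^ 2) <= trial_base d ^ (d ^ 2 - 1))%N.
Proof.
rewrite leq_eqVlt => /predU1P[<-|]; last exact: net_size_le4.
(* At d = 3 the inequality d^2 <= 2^d fails, so the two numbers are evaluated. *)
have h : ((21 * 3 ^ 3 * 2 ^ 6) ^ 9 <= (10 * 2 ^ 11 * 3 ^ 2) ^ 8)%N by lia.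
exact: h.
Qed.

Lemma net_size2_le : ((16 * 21) ^ 4 <= trial_base 2 ^ (2 ^ 2 - 1))%N.
Proof.
have h : ((16 * 21) ^ 4 <= (10 * 2 ^ 6 * 4) ^ 3)%N by lia.
exact: h.
Qed.

Variable R : realType.

(** [rc] is the diameter scale of the covering and [r] the landing radius; the gap between them
    absorbs the rounding of draws. The last two conditions feed [exists_landing_point] and bring the
    landing below 1 / (4 [alpha]). *)
Definition landing_net d (T : finType) (code : SU R d -> T) (rc r : R) : Prop :=
  [/\ rc < r,
      forall V V', code V = code V' -> opnorm (su_val V - su_val V') < rc,
      (#|T| <= trial_base d ^ (d ^ 2 - 1))%N,
      2 * (d ^ 2)%:R * r <= 9 / 50 &
      4 * alpha R d * (11 / 5 * (d ^ 3 + d ^ 4)%:R * r ^+ 2) < 1].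

Lemma landing_net2 : exists (T : finType) (code : SU R 2 -> T) (rc r : R), landing_net code rc r.
Proof.
(* 4 / 336 = 1/84 < 2/167 < 1/83: the landing estimate tolerates the radius 1/83, and 336^4 codes
   still fit under 1 / p. *)
have [m mE] : exists m, m.+1 = (16 * 21)%N by exists (16 * 21).-1.
have mR : m.+1%:R = 16 * 21 :> R by rewrite mE natrM.
have [|code hc] := @qubit_code R m (2 / 167).
  by rewrite mR; lra.
exists {ffun 'I_2 * 'I_2 -> 'I_m.+1}, code, (2 / 167), (1 / 83); split.
- lra.
- exact: hc.
- by rewrite card_ffun card_prod !card_ord mE; exact: net_size2_le.
- by rewrite natrX; lra.
- rewrite /alpha natrD !natrX (_ : (2 ^ 2 + 1)%N = 5)//; lra.
Qed.

Lemma landing_net3 d : (3 <= d)%N ->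
  exists (T : finType) (code : SU R d -> T) (rc r : R), landing_net code rc r.
Proof.
move=> d3; have d0 : (0 < d)%N by exact: leq_trans d3.
set e := ((d ^ 2 + 4)./2)%N; set m := (21 * d ^ 3 * 2 ^ e)%N.
have m0 : (0 < m)%N by rewrite /m !muln_gt0 !expn_gt0 d0.
pose q : R := d%:R ^+ 2 * 2 ^+ e.
have dR : 3 <= d%:R :> R by rewrite (ler_nat R 3).
have q0 : 0 < q by rewrite mulr_gt0 ?exprn_gt0//; lra.
(* The cell count gives 12 d / m = (100 / 175) / q; the denominators 174 and 172 then provide the
   two strict inequalities. *)
have [|code hc] := @cayley_code R d m.-1 (100 / 174 / q).
  rewrite prednK// /m !natrM !natrX ltr_pdivrMr; last first.
    by rewrite !mulr_gt0 ?exprn_gt0//; lra.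
  rewrite (_ : _ * (21 * _ * _) = 2100 / 174 * d%:R); last first.
    by rewrite /q; field; rewrite expf_neq0// pnatr_eq0 -lt0n.
  by rewrite ltr_pM2r; lra.
exists {ffun 'I_d * 'I_d -> 'I_m.-1.+1}, code, (100 / 174 / q), (100 / 172 / q).
have e3 : (d ^ 2 + 3 <= 2 * e)%N.
  have := odd_double_half (d ^ 2 + 4); rewrite -/e -mul2n; case: odd => /=; lia.
have q2 : 0 < q^-1 by rewrite invr_gt0.
split.
- by rewrite ltr_pM2r//; lra.
- exact: hc.
- by rewrite card_ffun card_prod !card_ord prednK// mulnn; exact: net_size_le.
- have -> : 2 * (d ^ 2)%:R * (100 / 172 / q) = 200 / 172 / 2 ^+ e.
    by rewrite /q natrX; field; rewrite expf_neq0//= pnatr_eq0 -lt0n.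
  have : 64 <= 2 ^+ e :> R.
    rewrite -natrX (ler_nat R 64) -[64%N]/(2 ^ 6)%N leq_exp2l//.
    have : (9 <= d ^ 2)%N by rewrite -mulnn; nia.
    lia.
  move: (2 ^+ e) => x x64; rewrite ler_pdivrMr; lra.
- rewrite /alpha.
  have aE : 4 * 2 ^+ (d ^ 2 + 1) <= 2 ^+ e * 2 ^+ e :> R.
    rewrite (_ : 4 = 2 ^+ 2); last by rewrite -natrX.
    by rewrite -!exprD ler_eXn2l ?ltr1n//; lia.
  have sE : (11 / 5 * (d ^ 3 + d ^ 4)%:R * (100 / 172 / q) ^+ 2) =
      11 / 5 * (1 + d%:R^-1) * (100 / 172) ^+ 2 * (2 ^+ e * 2 ^+ e)^-1.
    rewrite natrD !natrX /q; field.
    by rewrite expf_neq0//= pnatr_eq0 -lt0n.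
  have dV : d%:R^-1 <= 3^-1 :> R by rewrite lef_pV2 ?posrE//; lra.
  have dV0 : 0 < d%:R^-1 :> R by rewrite invr_gt0; lra.
  have z0 : 0 < 2 ^+ e * 2 ^+ e :> R by rewrite mulr_gt0 ?exprn_gt0.
  rewrite sE mulrA ltr_pdivrMr// mul1r.
  (* For d >= 3, 11/5 * (1 + 1/d) <= 44/15 < 295/100, and 295/100 * (100/172)^2 < 1 fixes the choice
     of 172. *)
  apply: lt_le_trans (_ : 2 ^+ e * 2 ^+ e * (295 / 100 * (100 / 172) ^+ 2) <= _); last by lra.
  apply: le_lt_trans (_ : 2 ^+ e * 2 ^+ e * (11 / 5 * (1 + d%:R^-1) * (100 / 172) ^+ 2) < _).
    by rewrite ler_wpM2r// !mulr_ge0//; lra.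
  by rewrite ltr_pM2l//; lra.
Qed.

Lemma exists_landing_net d : (2 <= d)%N ->
  exists (T : finType) (code : SU R d -> T) (rc r : R), landing_net code rc r.
Proof.
by rewrite leq_eqVlt => /predU1P[<-|]; [exact: landing_net2|exact: landing_net3].
Qed.

End LandingNet.

(** * Haar measure of balls and discretized draws *)

Section FiniteMeasurableMaps.
Variables (R : realType) (disp : measure_display) (X : measurableType disp).
Variable P : probability X R.

Lemma measurable_preimage_finType (I : finType) (c : X -> I) (S : pred I) :
  (forall i, measurable [set x | c x = i]) -> measurable [set x | S (c x)].
Proof.
move=> mc; rewrite (_ : [set x | S (c x)] = \bigcup_(i in [set i | S i]) [set x | c x = i]).
  by apply: fin_bigcup_measurable => [|i _]; [exact: finite_finset|exact: mc].
by apply/seteqP; split=> [x /= Sx|x [i /= Si cx]]; [exists (c x)|rewrite cx].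
Qed.

Lemma probability_finType_fibers (I : finType) (c : X -> I) (S : pred I) :
  (forall i, measurable [set x | c x = i]) ->
  (P [set x | S (c x)] = \sum_(i | S i) P [set x | c x = i])%E.
Proof.
move=> mc.
have [s us ms] : exists2 s : seq I, uniq s & forall i, S i = (i \in s).
  exists (enum S); first exact: enum_uniq.
  by move=> i; rewrite mem_enum.
rewrite (eq_bigl (mem s)) => [|i]; last by rewrite ms.
rewrite -big_uniq// (_ : [set x | S (c x)] = [set x | c x \in s]); last first.
  by apply/seteqP; split=> x /=; rewrite ms.
elim: s us {ms} => [_|i s IH /= /andP[si us]].
  rewrite big_nil (_ : [set x | _] = set0) ?measure0//.
  by apply/seteqP; split=> x.
rewrite big_cons -IH// -measureU//.
- congr (P _); apply/seteqP; split=> x /=; rewrite inE.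
    by move=> /orP[/eqP|]; [left|right].
  by case=> [->|->]; rewrite ?eqxx ?orbT.
- exact: (@measurable_preimage_finType _ c (mem s)).
- by apply/seteqP; split=> x //= [->]; rewrite (negbTE si).
Qed.

Lemma probability_le_sum (I : finType) (S : pred I) (A : set X) (F : I -> set X) :
  measurable A -> (forall i, measurable (F i)) ->
  (forall x, A x -> exists2 i, S i & F i x) ->
  (P A <= \sum_(i | S i) P (F i))%E.
Proof.
move=> mA mF AF.
have mU (s : seq I) : measurable (\big[setU/set0]_(i <- s | S i) F i).
  by apply: bigsetU_measurable.
apply: (@le_trans _ _ (P (\big[setU/set0]_(i | S i) F i))).
  apply: le_measure; [by rewrite inE|by rewrite inE; exact: mU|].
  move=> x /AF[i Si Fi]; rewrite (bigD1 i)//=; by left.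
elim: (index_enum I) mU => [|i s IH] mU.
  by rewrite !big_nil measure0.
rewrite !big_cons; case: ifP => [_|_]; last exact: IH.
apply: le_trans (measureU2 _ _ _) _; [exact: mF|exact: mU|].
by apply: leeD2l; exact: IH.
Qed.

End FiniteMeasurableMaps.

(** * Successive trials as weighted sums over finite words *)

Section TrialSums.
Variables (R : realFieldType) (S : Type) (T : finType).
Variables (step : S -> T -> S) (bad : S -> T -> bool).

(** Badness is tested at the state reached by the preceding letters, so the target may move with the
    history. *)
Fixpoint all_bad (j : nat) (st : S) (x : seq T) : bool :=
  if j is j'.+1 then
    if x is t :: x' then bad st t && all_bad j' (step st t) x' else true
  else true.

Lemma sum_tuple_recl k (Q : pred (k.+1.-tuple T)) (F : k.+1.-tuple T -> R) :
  \sum_(x | Q x) F x =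
  \sum_(t : T) \sum_(x : k.-tuple T | Q [tuple of t :: x]) F [tuple of t :: x].
Proof.
rewrite pair_big_dep /=.
rewrite (reindex (fun tx : T * k.-tuple T => [tuple of tx.1 :: tx.2])) //=.
exists (fun x : k.+1.-tuple T => (thead x, [tuple of behead x])) => [[t x]|x] _ /=.
  by congr (_, _); apply/val_inj.
by rewrite -tuple_eta.
Qed.

(** Replaces conditioning: after the first letter is split off, the tail bound holds uniformly in
    the state. The weights depend on the position, so that the induction can shift them. *)
Lemma sum_all_bad_le k (p : nat -> T -> R) (q : R) j st : 0 <= q -> (j <= k)%N ->
  (forall i t, 0 <= p i t) -> (forall i, \sum_t p i t <= 1) ->
  (forall i st, \sum_(t | bad st t) p i t <= q) ->
  \sum_(x : k.-tuple T | all_bad j st x) \prod_(i < k) p i (tnth x i) <= q ^+ j.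
Proof.
move=> q0; elim: k p j st => [|k IH] p j st jk p0 p1 pq.
  move: jk; rewrite leqn0 => /eqP ->; rewrite expr0.
  rewrite (eq_bigr (fun=> 1)) => [|x _]; last by rewrite big_ord0.
  by rewrite sumr_const card_tuple expn0.
rewrite sum_tuple_recl.
have sum_rec j' st' t :
    (j' <= k)%N ->
    \sum_(x : k.-tuple T | all_bad j' st' x)
      \prod_(i < k.+1) p i (tnth [tuple of t :: x] i) <= p 0%N t * q ^+ j'.
  move=> jk'; under eq_bigr do rewrite big_ord_recl tnth0.
  rewrite -mulr_sumr ler_wpM2l//; apply: le_trans (IH (fun i => p i.+1) _ _ jk' _ _ _) => //.
  rewrite le_eqVlt; apply/orP; left; apply/eqP; apply: eq_bigr => x _.
  by apply: eq_bigr => i _; rewrite tnthS.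
case: j jk => [|j] jk /=.
  apply: (@le_trans _ _ (\sum_t p 0%N t)); last by rewrite expr0.
  by apply: ler_sum => t _; have := sum_rec 0%N st t isT; rewrite expr0 mulr1.
apply: (@le_trans _ _ (\sum_(t | bad st t) p 0%N t * q ^+ j)).
  rewrite [leRHS]big_mkcond; apply: ler_sum => t _.
  case: (bad st t) => /=; last by rewrite big_pred0_eq.
  exact: sum_rec.
by rewrite -mulr_suml exprS ler_wpM2r ?exprn_ge0.
Qed.

End TrialSums.

Section HaarBalls.
Variables (R : realType) (d : nat).

Definition su_ball (V0 : SU R d) (r : R) : set (borelSU R d) :=
  [set V : SU R d | opnorm (su_val V - su_val V0) < r].

Lemma measurable_su_ball V0 r : measurable (su_ball V0 r).
Proof.
apply: sub_sigma_algebra => A hA.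
exists (r - opnorm (su_val A - su_val V0)); first by rewrite subr_gt0.
move=> B hB; rewrite /su_ball /=.
apply: le_lt_trans (opnorm_triangle _ (su_val A) _) _.
by rewrite -ltrBrDr.
Qed.

Lemma haar_ball_ge (mu : probability (borelSU R d) R) (T : finType)
    (code : SU R d -> T) (r : R) : is_haar mu ->
  (forall V V', code V = code V' -> opnorm (su_val V - su_val V') < r) ->
  forall V0, ((#|T|%:R^-1)%:E <= mu (su_ball V0 r))%E.
Proof.
move=> hmu hcode V0.
have ball1 W : mu (su_ball W r) = mu (su_ball (su1 R d) r).
  apply: etrans (esym (hmu W _ (measurable_su_ball W r))) _; apply: (congr1 mu).
  have uW := su_unitary W.
  apply/seteqP; split=> V /=; rewrite /su_ball /= => h.
    apply: le_lt_trans h; have -> : su_val V - 1%:M =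
        (su_val W)^t* *m (su_val W *m su_val V - su_val W).
      by rewrite mulmxBr mulmxA (unitarymxPl uW) mul1mx.
    by apply: opnorm_unitaryMl; exact: adj_unitary.
  apply: le_lt_trans h; rewrite -[X in _ *m _ - X]mulmx1 -mulmxBr.
  exact: opnorm_unitaryMl.
(* A code that is not attained gets the default [su1]; its ball has the same measure as the others,
   so the count stays valid. *)
pose rep t := xget (su1 R d) [set V | code V = t].
have [x xE] : exists x : R, mu (su_ball (su1 R d) r) = x%:E.
  exists (fine (mu (su_ball (su1 R d) r))); rewrite fineK//.
  by apply: fin_num_measure; exact: measurable_su_ball.
have : (mu setT <= \sum_(t : T) mu (su_ball (rep t) r))%E.
  apply: (@probability_le_sum _ _ _ mu T xpredT) => //= [t|V _].
    exact: measurable_su_ball.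
  exists (code V) => //; apply: hcode; apply/esym.
  exact: (@xgetPex _ (su1 R d) [set V' | code V' = code V] (ex_intro _ V erefl)).
rewrite probability_setT (eq_bigr (fun=> x%:E)) => [|t _]; last by rewrite ball1.
rewrite ball1 xE sumEFin !lee_fin sumr_const => h.
have T0 : (0 < #|T|)%N by apply/card_gt0P; exists (code V0).
by rewrite -div1r ler_pdivrMr ?ltr0n// mulr_natr.
Qed.

(** The Cayley code involves choices and need not be Borel. Recording which balls around its
    representatives contain V has Borel fibres, and any recorded ball supplies a nearby
    representative. *)
Lemma exists_measurable_code (tau : R) : 0 < tau ->
  exists (T : finType) (c : SU R d -> T) (rep : T -> SU R d),
    (forall V, opnorm (su_val V - su_val (rep (c V))) < tau) /\
    forall t, measurable [set V : borelSU R d | c V = t].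
Proof.
move=> tau0.
have [m hm] : exists m, 12 * d%:R / m.+1%:R < tau.
  exists (Num.truncn (12 * d%:R / tau)); rewrite ltr_pdivrMr// [tau * _]mulrC -ltr_pdivrMr//.
  exact: truncnS_gt.
have [T0 [code hcode]] : exists (T0 : finType) (code : SU R d -> T0),
    forall V V', code V = code V' -> opnorm (su_val V - su_val V') < tau.
  by have [code hcode] := @cayley_code R d m tau hm; exists {ffun 'I_d * 'I_d -> 'I_m.+1}, code.
pose rep0 t := xget (su1 R d) [set V | code V = t].
pose c (V : SU R d) := [ffun t : T0 => `[< su_ball (rep0 t) tau V >]].
pose rep (f : {ffun T0 -> bool}) :=
  if [pick t | f t] is Some t then rep0 t else su1 R d.
exists {ffun T0 -> bool}, c, rep; split=> [V|f].
  rewrite /rep; case: pickP => [t|/(_ (code V))]; first by rewrite ffunE => /asboolP.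
  rewrite ffunE => /asboolP; case; apply: hcode; apply/esym.
  exact: (@xgetPex _ (su1 R d) [set V' | code V' = code V] (ex_intro _ V erefl)).
rewrite (_ : [set V | _] = \bigcap_(t in [set: T0])
    (if f t then su_ball (rep0 t) tau else ~` su_ball (rep0 t) tau)).
  apply: fin_bigcap_measurable => [|t _]; first exact: finite_finset.
  by case: (f t); [|apply: measurableC]; exact: measurable_su_ball.
apply/seteqP; split=> V /=.
  by move=> <- t _; rewrite ffunE; case: asboolP.
move=> h; apply/ffunP => t; rewrite ffunE; have := h t I.
by case: (f t) => h'; [apply/asboolP|apply/asboolPn].
Qed.

End HaarBalls.

(** * Draws rounded to finite codes *)

Section DiscretizedDraws.
Variables (R : realType) (d k : nat).
Variables (disp : measure_display) (X : measurableType disp).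
Variables (P : probability X R) (V : 'I_k -> {RV P >-> borelSU R d}).

Lemma measurable_draw i (B : set (borelSU R d)) : measurable B ->
  measurable [set w | B (V i w)].
Proof.
move=> mB; have := measurable_funP (V i) measurableT B mB.
by rewrite setTI.
Qed.

Definition coded_draws (T : finType) (c : SU R d -> T) (w : X) : k.-tuple T :=
  [tuple c (V i w) | i < k].

Lemma coded_draws_fiber (T : finType) (c : SU R d -> T) y :
  [set w | coded_draws c w = y] =
  [set w | forall i, i \in [set: 'I_k]%SET -> [set W | c W = tnth y i] (V i w)].
Proof.
apply/seteqP; split=> w /=; first by move=> <- i _; rewrite tnth_mktuple.
by move=> h; apply: eq_from_tnth => i; rewrite tnth_mktuple h ?inE.
Qed.

Lemma measurable_coded_draws (T : finType) (c : SU R d -> T) y :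
  (forall t, measurable [set W : borelSU R d | c W = t]) ->
  measurable [set w | coded_draws c w = y].
Proof.
move=> mc; rewrite coded_draws_fiber.
rewrite (_ : [set w | _] = \bigcap_(i in [set: 'I_k]) [set w | c (V i w) = tnth y i]).
  apply: fin_bigcap_measurable => [|i _]; first exact: finite_finset.
  exact: (measurable_draw i (mc _)).
by apply/seteqP; split=> w /= h i _; apply: h; rewrite ?inE.
Qed.

Lemma opnorm_dist (A B D : 'M[R[i]]_d) :
  `|opnorm (A - D) - opnorm (B - D)| <= opnorm (A - B).
Proof.
have := opnorm_triangle A B D; have := opnorm_triangle B A D.
rewrite [opnorm (B - A)]opnormB.
move: (opnorm (A - D)) (opnorm (B - D)) (opnorm (A - B)) => x y z h1 h2.
by rewrite ler_norml; lra.
Qed.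

Lemma nth_map_dist (I : Type) (s : seq I) (f g : I -> SU R d) (t : R) i : 0 <= t ->
  (forall j, opnorm (su_val (f j) - su_val (g j)) <= t) ->
  opnorm (su_val (nth (su1 R d) [seq f j | j <- s] i) -
          su_val (nth (su1 R d) [seq g j | j <- s] i)) <= t.
Proof.
move=> t0 h; elim: s i => [|a s IH] [|i] //=; rewrite ?subrr ?opnorm0//.
Qed.

Lemma su_F_coded_dist (T : finType) (c : SU R d -> T) (rep : T -> SU R d) (t : R)
    (U : SU R d) w : 0 <= t ->
  (forall W, opnorm (su_val W - su_val (rep (c W))) <= t) ->
  opnorm (su_val (su_F [seq V i w | i <- enum 'I_k] U) -
          su_val (su_F [seq rep y | y <- coded_draws c w] U)) <=
  (d ^ 2 * 2 + 1)%:R ^+ k * t.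
Proof.
move=> t0 hc; have -> : [seq rep y | y <- coded_draws c w] =
    [seq (rep \o (fun i => c (V i w))) i | i <- enum 'I_k].
  by rewrite /coded_draws /= -map_comp; congr map; exact: val_ord_tuple.
have := @su_F_lipschitz R d [seq V i w | i <- enum 'I_k]
  [seq (rep \o (fun i => c (V i w))) i | i <- enum 'I_k] U U t.
have sz (I : Type) (f : 'I_k -> I) : size [seq f i | i <- enum 'I_k] = k.
  by rewrite size_map size_enum_ord.
rewrite !sz subrr opnorm0 add0r; apply => // i.
by apply: nth_map_dist => // j; exact: hc.
Qed.

Definition final_distance (U : SU R d) (w : X) : R :=
  opnorm (su_val (su_F [seq V i w | i <- enum 'I_k] U) - 1%:M).

(* The event is a countable intersection of events depending on finite codes of
   the draws, so no measurability on the product space is needed. *)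
Lemma measurable_final_distance (U : SU R d) (eps : R) :
  measurable [set w | final_distance U w <= eps].
Proof.
pose L : R := (d ^ 2 * 2 + 1)%:R ^+ k.
have L0 : 0 <= L by rewrite exprn_ge0.
(* Rounding at scale 1 / (n + 1) moves the distance by at most L / (n + 1) either way, so relaxing
   the rounded event by this amount sandwiches the true one. *)
have approx (n : nat) : exists A : set X, [/\ measurable A,
    [set w | final_distance U w <= eps] `<=` A &
    forall w, A w -> final_distance U w <= eps + 2 * (L * n.+1%:R^-1)].
  have t0 : 0 < n.+1%:R^-1 :> R by rewrite invr_gt0.
  have [T [c [rep [hc mc]]]] := exists_measurable_code d t0.
  pose D (w : X) := opnorm (su_val (su_F [seq rep y | y <- coded_draws c w] U) - 1%:M).
  have hD w : `|final_distance U w - D w| <= L * n.+1%:R^-1.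
    have hw := @su_F_coded_dist T c rep _ U w (ltW t0) (fun W => ltW (hc W)).
    exact: le_trans (opnorm_dist _ _ _) hw.
  exists [set w | [pred y : k.-tuple T | opnorm (su_val (su_F [seq rep t | t <- y] U) - 1%:M)
    <= eps + L * n.+1%:R^-1] (coded_draws c w)]; split.
  - apply: measurable_preimage_finType => y; exact: measurable_coded_draws.
  - move=> w /= h; have := hD w; rewrite -/(D w) ler_norml => /andP[h1 h2].
    by move: (D w) (final_distance U w) (L / _) h h1 h2 => *; lra.
  - move=> w /=; have := hD w; rewrite -/(D w) ler_norml => /andP[h1 h2] h.
    by move: (D w) (final_distance U w) (L / _) h h1 h2 => *; lra.
have [A hA] := choice approx.
rewrite (_ : [set w | _] = \bigcap_n A n).
  by apply: bigcap_measurable => // n _; have [] := hA n.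
apply/seteqP; split=> [w hw n _|w hw /=]; first by have [_ sub _] := hA n; exact: sub.
apply/ler_addgt0Pr => e e0.
pose n := Num.truncn (2 * L / e).
have [_ _ /(_ w (hw n I)) /le_trans] := hA n; apply; rewrite lerD2l.
rewrite mulrA ler_pdivrMr// [e * _]mulrC -ler_pdivrMr//; apply: ltW; exact: truncnS_gt.
Qed.

End DiscretizedDraws.

(** * Probability of success *)

Section SuccessProbability.
Variable R : realType.

(** A good draw among the first j leaves at least [size x - j] rounds, each squaring the bound;
    since y <= 1, landing earlier only helps. *)
Lemma all_bad_contraction d (T : finType) (rep : T -> SU R d)
    (bad : SU R d -> T -> bool) (y : R) : (2 <= d)%N -> 0 <= y -> y <= 4^-1 ->
  (forall st t, ~~ bad st t ->
    alpha R d * opnorm (su_val (su_f (su_g (rep t) st)) - 1%:M) <= y) ->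
  forall j (x : seq T) st, (j <= size x)%N ->
  ~~ all_bad (fun st t => su_f (su_g (rep t) st)) bad j st x ->
  alpha R d * opnorm (su_val (su_F [seq rep t | t <- x] st) - 1%:M) <=
  y ^+ (2 ^ (size x - j)).
Proof.
move=> d2 y0 y4 good; elim=> [//|j IH] [//|t x] st /= jx.
rewrite negb_and subSS => /orP[/good h|]; last exact: IH.
apply: le_trans (su_F_contraction _ d2 (le_trans h y4)) _.
rewrite size_map; apply: (@le_trans _ _ (y ^+ (2 ^ size x))).
  apply: lerXn2r h; rewrite nnegrE//; apply: mulr_ge0 (opnorm_ge0 _).
  exact: ltW (alpha_gt0 R d).
have y1 : y <= 1 by apply: (le_trans y4); lra.
by apply: ler_wiXn2l => //; rewrite leq_exp2l// leq_subr.
Qed.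

Lemma haar_draw_ball d (disp : measure_display) (X : measurableType disp)
    (P : probability X R) (W : {RV P >-> borelSU R d}) (T : finType)
    (code : SU R d -> T) (r : R) : is_haar (distribution P W) ->
  (forall V V', code V = code V' -> opnorm (su_val V - su_val V') < r) ->
  forall V0, ((#|T|%:R^-1)%:E <= P [set w | su_ball V0 r (W w)])%E.
Proof.
move=> hW hcode V0.
pose mu : probability (borelSU R d) R := distribution P W.
have distE B : P [set w | B (W w)] = mu B by [].
move: hW; rewrite -/mu => hW; rewrite (distE (su_ball V0 r)).
move: mu hW {distE} => mu hW; exact: (haar_ball_ge hW hcode V0).
Qed.

Lemma success_probability d k j (eps : R) (disp : measure_display)
    (X : measurableType disp) (P : probability X R)
    (V : 'I_k -> {RV P >-> borelSU R d}) (U : SU R d) :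
  (2 <= d)%N -> (j <= k)%N ->
  (forall y : R, 0 <= y -> y < 4^-1 -> y ^+ (2 ^ (k - j)) < alpha R d * eps) ->
  haar_draws V ->
  ((1 - (1 - succ_prob R d) ^+ j)%:E <= P [set w | (final_distance V U w <= eps)%R])%E.
Proof.
move=> d2 jk heps [haarV indepV].
have d0 : (0 < d)%N by exact: ltnW.
have [T0 [code [rc [r [rcr hcode cardT0 rsmall rsq]]]]] := exists_landing_net R d2.
set rho := 11 / 5 * _ * _ in rsq.
have a0 := alpha_gt0 R d.
have rho0 : 0 <= rho by rewrite /rho mulr_ge0 ?sqr_ge0// mulr_ge0.
pose y := alpha R d * rho.
have y0 : 0 <= y by rewrite mulr_ge0// ltW.
have y4 : y < 4^-1 by rewrite /y; move: rsq; rewrite -mulrA => ?; lra.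
have ye := heps y y0 y4.
pose eps' := y ^+ (2 ^ (k - j)) / alpha R d.
have ee : eps' < eps by rewrite /eps' ltr_pdivrMr// mulrC.
pose L : R := (d ^ 2 * 2 + 1)%:R ^+ k.
have L0 : 0 < L by rewrite exprn_gt0// ltr0n addn1.
(* The rounding scale has two budgets: the gap between the radii, and the slack in [eps] divided by
   the Lipschitz constant. *)
pose tau := Num.min (r - rc) ((eps - eps') / L).
have tau0 : 0 < tau by rewrite lt_min subr_gt0 rcr divr_gt0// subr_gt0.
have tau_r : rc + tau <= r by rewrite -lerBrDl ge_min lexx.
have tau_e : L * tau <= eps - eps' by rewrite mulrC -ler_pdivlMr// ge_min lexx orbT.
have [T [c [rep [hc mc]]]] := exists_measurable_code d tau0.
have [V0 hV0] := choice (fun st : SU R d => exists_landing_point st d0).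
(* Badness is judged on the representative with the radius r: a draw within rc of the target has a
   good representative, because rc + tau <= r. *)
pose bad (st : SU R d) (t : T) := ~~ (opnorm (su_val (rep t) - su_val (V0 st)) < r).
pose step (st : SU R d) (t : T) := su_f (su_g (rep t) st).
have good st t : ~~ bad st t ->
    alpha R d * opnorm (su_val (su_f (su_g (rep t) st)) - 1%:M) <= y.
  rewrite negbK => h; rewrite /y ler_pM2l//.
  by apply: hV0 => //; exact: ltW.
have mE := measurable_final_distance V U eps.
have mfib i t : measurable [set w | c (V i w) = t] by exact: (measurable_draw V i (mc t)).
(* Extended by 0 beyond k, since [sum_all_bad_le] takes weights indexed by [nat]. *)
pose p (i : nat) (t : T) : R :=
  if insub i is Some i' then fine (P [set w | c (V i' w) = t]) else 0.
have pE (i : 'I_k) t : P [set w | c (V i w) = t] = (p i t)%:E.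
  by rewrite /p valK fineK//; exact: fin_num_measure (mfib i t).
have psum (i : 'I_k) (S : pred T) :
    P [set w | S (c (V i w))] = (\sum_(t | S t) p i t)%:E.
  rewrite (probability_finType_fibers P S (mfib i)) -sumEFin.
  by apply: eq_bigr => t _; exact: pE.
have p_ord (Q : nat -> Prop) : (forall i : 'I_k, Q i) ->
    (forall i, (forall t, p i t = 0) -> Q i) -> forall i, Q i.
  move=> h1 h2 i; case: (ltnP i k) => ik; first exact: (h1 (Ordinal ik)).
  by apply: h2 => t; rewrite /p insubF// ltnNge ik.
have sp1 := succ_prob_lt1 R d2.
have cardle : succ_prob R d <= #|T0|%:R^-1.
  have T00 : (0 < #|T0|)%N by apply/card_gt0P; exists (code (su1 R d)).
  rewrite succ_probE// lef_pV2 ?posrE ?ltr0n ?(leq_trans T00)//.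
  by rewrite ler_nat.
have p_ge0 i t : 0 <= p i t.
  rewrite /p; case: insub => // i'.
  by apply: fine_ge0; exact: measure_ge0.
have p_le1 i : \sum_t p i t <= 1.
  apply: (p_ord (fun i => \sum_t p i t <= 1)) i => [i|i p0]; last by rewrite big1.
  rewrite -lee_fin -(psum i xpredT).
  by apply: probability_le1; exact: (measurable_preimage_finType xpredT (mfib i)).
have p_bad i st : \sum_(t | bad st t) p i t <= 1 - succ_prob R d.
  apply: (p_ord (fun i => \sum_(t | bad st t) p i t <= _)) i => [i|i p0]; last first.
    by rewrite big1// subr_ge0 ltW.
  rewrite -lee_fin -(psum i (bad st)).
  have mB := measurable_su_ball (V0 st) rc.
  have mVB : measurable [set w | su_ball (V0 st) rc (V i w)] := measurable_draw V i mB.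
  apply: (@le_trans _ _ (P (~` [set w | su_ball (V0 st) rc (V i w)]))).
    apply: le_measure.
    - by rewrite inE; exact: (measurable_preimage_finType (bad st) (mfib i)).
    - by rewrite inE; exact: measurableC.
    move=> w /= hb hball; move/negP: hb; apply.
    apply: le_lt_trans (opnorm_triangle _ (su_val (V i w)) _) _.
    apply: lt_le_trans tau_r; rewrite addrC; apply: ltrD; first exact: hball.
    by rewrite opnormB; exact: hc.
  rewrite probability_setC// EFinB leeB// ?lexx//.
  apply: le_trans (haar_draw_ball (haarV i) hcode (V0 st)).
  by rewrite lee_fin.
have boxE (x : k.-tuple T) : P [set w | coded_draws V c w = x] =
    (\prod_(i < k) p i (tnth x i))%:E.
  rewrite coded_draws_fiber.
  rewrite (indepV [set: 'I_k]%SET (fun i => [set W : borelSU R d | c W = tnth x i])).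
    2: by move=> i _; exact: mc.
  rewrite -prodEFin; apply: eq_big => [i|i _]; first by rewrite inE.
  exact: pE.
have compl : (P (~` [set w | (final_distance V U w <= eps)%R]) <=
    ((1 - succ_prob R d) ^+ j)%:E)%E.
  (* If the distance exceeds [eps], the code word must be all bad: otherwise the rounded orbit ends
     within eps' of 1, and rounding adds at most eps - eps'. *)
  apply: (@le_trans _ _ (\sum_(x : k.-tuple T | all_bad step bad j U x)
      P [set w | coded_draws V c w = x])%E).
    apply: probability_le_sum; first exact: measurableC.
      by move=> x; exact: measurable_coded_draws.
    move=> w /= hw; exists (coded_draws V c w) => //.
    apply/negPn/negP => nb; apply: hw.
    have := all_bad_contraction d2 y0 (ltW y4) good _ nb.
    rewrite size_tuple => /(_ jk); rewrite mulrC -ler_pdivlMr// -/eps' => he.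
    apply: le_trans (opnorm_triangle _ (su_val (su_F [seq rep t | t <- coded_draws V c w] U)) _) _.
    have hd := @su_F_coded_dist _ _ _ _ _ _ V _ c rep _ U w (ltW tau0) (fun W => ltW (hc W)).
    apply: le_trans (lerD hd he) _; rewrite -lerBrDr; exact: tau_e.
  under eq_bigr do rewrite boxE.
  rewrite sumEFin lee_fin; apply: sum_all_bad_le => //.
  by rewrite subr_ge0 ltW.
have := probability_setC P (measurableC mE); rewrite setCK => ->.
by rewrite EFinB leeB// ?lexx.
Qed.

Lemma doublings_le d (eps : R) n : 0 < eps -> eps < 1 / alpha R d ->
  doublings d eps <= n%:R -> (2^-1) ^+ (2 ^ n) <= alpha R d * eps.
Proof.
move=> e0 ea hn; have a0 := alpha_gt0 R d.
have ln2 : 0 < ln 2 :> R by rewrite ln_gt0// ltr1n.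
have ae0 : 0 < alpha R d * eps by rewrite mulr_gt0.
have ae1 : 1 < 1 / (alpha R d * eps).
  by rewrite div1r invf_gt1//; move: ea; rewrite ltr_pdivlMr// mulrC.
set z := 1 / (alpha R d * eps) in ae1.
have z0 : 0 < z by exact: lt_trans ae1.
have L0 : 0 < log2 z by rewrite /log2 divr_gt0// ln_gt0.
have : log2 z <= 2 ^+ n.
  rewrite -ler_ln ?posrE ?exprn_gt0// lnXn// -[_ *+ n]mulr_natl.
  by move: hn; rewrite /doublings -/z {1}/log2 ler_pdivrMr.
rewrite {1}/log2 ler_pdivrMr// -natrX mulr_natl -lnXn// ler_ln ?posrE ?exprn_gt0//.
rewrite /z div1r exprVn => h.
by rewrite -[leRHS]invrK lef_pV2 ?posrE ?invr_gt0 ?exprn_gt0.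
Qed.

Lemma trials_le d (eta : R) n : (2 <= d)%N -> 0 < eta ->
  trials d eta <= n%:R -> (1 - succ_prob R d) ^+ n <= eta.
Proof.
move=> d2 h0 hn; have ln2 : 0 < ln 2 :> R by rewrite ln_gt0// ltr1n.
have p0 := succ_prob_gt0 R (ltnW d2); have p1 := succ_prob_lt1 R d2.
have q0 : 0 < 1 - succ_prob R d by rewrite subr_gt0.
have lq : ln (1 - succ_prob R d) < 0 by apply: ln_lt0; lra.
rewrite -ler_ln ?posrE ?exprn_gt0// lnXn// -mulr_natl.
move: hn; rewrite /trials /log2 invf_div mulrA divfK ?gt_eqF//.
by rewrite ler_ndivrMr.
Qed.

(* A landing at distance below [1 / (4 * alpha)], half of what is needed for
   [doublings], makes up for rounding [doublings] up to an integer. *)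
Lemma split_draws d (eps eta : R) k : (2 <= d)%N ->
  0 < eps -> eps < 1 / alpha R d -> 0 < eta -> eta < 1 ->
  trials d eta + doublings d eps <= k%:R -> trials d eta <= k%:R ->
  exists2 j, (j <= k)%N & trials d eta <= j%:R /\
    forall y : R, 0 <= y -> y < 4^-1 -> y ^+ (2 ^ (k - j)) < alpha R d * eps.
Proof.
move=> d2 e0 ea h0 h1 hk hk'.
have t0 : 0 < trials d eta.
  have p0 := succ_prob_gt0 R (ltnW d2); have p1 := succ_prob_lt1 R d2.
  have ln2 : 0 < ln 2 :> R by rewrite ln_gt0// ltr1n.
  have lq : ln (1 - succ_prob R d) < 0 by apply: ln_lt0; lra.
  have le : ln eta < 0 by apply: ln_lt0; rewrite h0.
  rewrite /trials /log2 invf_div mulrA divfK ?gt_eqF//.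
  by rewrite nmulr_rgt0// invr_lt0.
have sq n (y : R) : 0 <= y -> y < 4^-1 -> y ^+ (2 ^ n) < (2^-1) ^+ (2 ^ n.+1).
  move=> y0 y4; rewrite expnS exprM; rewrite ltr_pXn2r ?nnegrE ?expn_gt0//.
  by apply: lt_le_trans y4 _; lra.
(* Then 1/2 <= [alpha R d * eps], so a single landing already suffices and every draw can count as a
   trial. *)
case: (lerP (doublings d eps) 0) => hD.
  exists k => //; split=> // y y0 y4; rewrite subnn.
  have := doublings_le (n := 0) e0 ea hD; rewrite expn0 expr1 => h.
  by apply: lt_le_trans h; rewrite expr1; apply: lt_trans y4 _; lra.
(* Rounding down keeps k - s >= [trials]; starting from 1/4 = (1/2)^2, s squarings reach (1/2)^(2^(s
   + 1)), and s + 1 exceeds [doublings]. *)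
pose s := Num.truncn (doublings d eps).
have /andP[sl su] : s%:R <= doublings d eps < s.+1%:R by apply: truncn_itv; exact: ltW.
have sk : (s <= k)%N by rewrite -(ler_nat R); lra.
exists (k - s)%N; first exact: leq_subr.
split; first by rewrite natrB//; lra.
move=> y y0 y4; rewrite subKn//.
exact: lt_le_trans (sq s y y0 y4) (doublings_le e0 ea (ltW su)).
Qed.

End SuccessProbability.

Theorem mainTheorem2 (R : realType) :
  exists h : nat -> R,
    h =O_\oo (fun d : nat => d%:R ^+ 4 : R) /\
    forall (d : nat) (eps eta : R) (k : nat),
      (2 <= d)%N -> 0 < eps -> eps < 1 / alpha R d -> 0 < eta -> eta < 1 ->
      (0 < k)%N -> trials d eta + doublings d eps <= k%:R ->
    [/\ trials d eta <= k%:R ->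
        forall (disp : measure_display) (T : measurableType disp)
          (P : probability T R) (V : 'I_k -> {RV P >-> borelSU R d}),
          haar_draws V ->
        forall U : SU R d,
          ((1 - eta)%:E <=
           P [set w | (opnorm (su_val (su_F [seq V i w | i <- enum 'I_k] U)
                               - 1%:M) <= eps)%R])%E,
        forall Vs : k.-tuple (SU R d),
        exists (W : 'M[R[i]]_d) (Q : 'I_(d ^ (2 * k)) -> 'M[R[i]]_d),
          [/\ W \is unitarymx, forall j, Q j \is unitarymx &
              forall U : SU R d,
                W *m su_val (su_F Vs U) *m W^t*
                = \prod_(j < d ^ (2 * k)) (Q j *m su_val U)] &
        k%:Z = Num.ceil (trials d eta + doublings d eps) ->
        (d ^ (2 * k))%:R <=
          d%:R ^+ 2 * (1 / eta) `^ (2 `^ h d)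
          * (log2 (1 / eps) - d%:R ^+ 2 - 1) `^ (2 * log2 d%:R) :> R].
Proof.
(* The constant 20 is the one of [pulse_exponent_le]. *)
exists (fun d => 20 * d%:R ^+ 4); split; first exact: bigO_pow4.
move=> d eps eta k d2 e0 ea h0 h1 _ hk; split.
(* [hk'] matters when [doublings] is negative: the sum may then be smaller than the number of trials
   that k has to cover. *)
- move=> hk' disp T P V haarV U.
  have [j jk [tj hy]] := split_draws d2 e0 ea h0 h1 hk hk'.
  apply: le_trans (success_probability U d2 jk hy haarV).
  by rewrite lee_fin lerD2l lerN2; exact: trials_le.
- by move=> Vs; apply: su_F_pulses; exact: ltnW.
- exact: pulse_count_le.
Qed.
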